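(* For every $n\ge1$, the number of Yukawa 1PI tadpole graphs with loop number $n$ equals $C_n$, the number of connected chord diagrams with $n$ chords. Equivalently, if $T(x)=\sum_\Gamma x^{b(\Gamma)}$, the sum over isomorphism classes of Yukawa 1PI tadpoles and $b(\Gamma)$ the number of boson edges including the external leg, then $T(x)=C(x)$, and $T$ satisfies $2xT(x)T'(x)=T(x)^2+T(x)-x$. (In the paper's notation, $[\hbar^n]\partial_{\phi_c}G^{\mathrm{Yuk}}|_{\phi_c=\psi_c=0}=C_n$.)
   Context: Yukawa graphs: vertices each incident to exactly one incoming fermion half-edge, one outgoing fermion half-edge and one boson half-edge; internal edges are directed fermion edges (outgoing paired with incoming half-edge) or boson edges (two boson half-edges); unpaired half-edges are external legs; fermion cycles are allowed. A graph is 1PI if connected and it stays connected after removing any one internal edge. A tadpole is a 1PI Yukawa graph whose only external leg is a single boson leg. Graphs are counted up to isomorphisms preserving edge types and orientations and fixing the external legs. Loop number $=|E|-|V|+1$ with $E$ the internal edges; for tadpoles it equals the total number of boson edges including the external leg. Chord diagrams are perfect matchings of $\{1,\dots,2n\}$; connected means the intersection graph (chords adjacent iff $\{a<b\},\{c<d\}$ satisfy $a<c<b<d$ or $c<a<d<b$) is connected; $C(x)=\sum C_nx^n$ is their generating function. *)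

(* Defs.v *)
From mathcomp Require Import all_boot all_fingroup.
Set Implicit Arguments. Unset Strict Implicit. Unset Printing Implicit Defensive.

(* Points are 'I_(2n) (i.e. 0..2n-1 in place of 1..2n).
   A chord diagram is a perfect matching: a partition of the points into
   blocks (chords) of size exactly 2. *)
Definition perfect_matching (k : nat) (M : {set {set 'I_k}}) : bool :=
  partition M [set: 'I_k] && [forall C in M, #|C| == 2].

Definition chords_cross (k : nat) (C D : {set 'I_k}) : bool :=
  [exists a : 'I_k, exists b : 'I_k, exists c : 'I_k, exists d : 'I_k,
     [&& a \in C, b \in C, c \in D, d \in D &
        ((a < c < b) && (b < d)) || ((c < a < d) && (d < b))]].

Definition intersection_rel (k : nat) (M : {set {set 'I_k}}) : rel {set 'I_k} :=
  fun C D => [&& C \in M, D \in M & chords_cross C D].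

Definition cd_connected (k : nat) (M : {set {set 'I_k}}) : bool :=
  [forall C in M, forall D in M, connect (intersection_rel M) C D].

Definition chord_count (n : nat) : nat :=
  #|[set M : {set {set 'I_(n.*2)}} | perfect_matching M && cd_connected M]|.

(* A Yukawa graph on vertex set 'I_V all of whose fermion half-edges are
   internal is given by
   - sigma : {perm 'I_V}: the outgoing fermion half-edge of v is paired with
     the incoming fermion half-edge of (sigma v)   (fermion edge v -> sigma v);
   - beta : {perm 'I_V}, an involution: the boson half-edge of v is paired with
     the boson half-edge of (beta v) if beta v != v, and is an external
     boson leg if beta v = v.
   Fermion edges are indexed by their source vertex; boson edges are the
   2-sets [set v; beta v] with beta v != v. *)

Definition graph_rel (V : nat) (sigma beta : {perm 'I_V})
    (dropF : pred 'I_V) (dropB : pred {set 'I_V}) : rel 'I_V :=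
  fun x y =>
    [|| (sigma x == y) && ~~ dropF x,
        (sigma y == x) && ~~ dropF y
      | [&& beta x == y, x != y & ~~ dropB [set x; y]]].

Definition rel_connected (V : nat) (r : rel 'I_V) : bool :=
  [forall x, forall y, connect r x y].

Definition is_1PI (V : nat) (sigma beta : {perm 'I_V}) : bool :=
  [&& rel_connected (graph_rel sigma beta pred0 pred0),
      [forall e, rel_connected (graph_rel sigma beta (pred1 e) pred0)] &
      [forall e, (beta e != e) ==>
          rel_connected (graph_rel sigma beta pred0 (pred1 [set e; beta e]))]].

Definition boson_edges (V : nat) (beta : {perm 'I_V}) : {set {set 'I_V}} :=
  [set [set v; beta v] | v in [set v | beta v != v]].

(* loop number |E| - |V| + 1, with |E| = V fermion edges + boson edges *)
Definition loop_number (V : nat) (sigma beta : {perm 'I_V}) : nat :=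
  (V + #|boson_edges beta|).+1 - V.

Definition is_tadpole (V : nat) (sigma beta : {perm 'I_V}) : bool :=
  [&& [forall v, beta (beta v) == v],
      #|[set v | beta v == v]| == 1 & is_1PI sigma beta].

(* isomorphism: vertex bijection preserving fermion edges with orientation
   and boson edges (it then automatically maps the unique external leg to
   the unique external leg). *)
Definition yiso (V : nat) (g h : {perm 'I_V} * {perm 'I_V}) : bool :=
  [exists phi : {perm 'I_V}, forall v,
     (phi (g.1 v) == h.1 (phi v)) && (phi (g.2 v) == h.2 (phi v))].

(* a tadpole with loop number n has exactly 2n-1 vertices *)
Definition tadpoles (n : nat) : {set {perm 'I_(n.*2.-1)} * {perm 'I_(n.*2.-1)}} :=
  [set g | is_tadpole g.1 g.2 && (loop_number g.1 g.2 == n)].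

Definition tadpole_count (n : nat) : nat :=
  #|[set [set h in tadpoles n | yiso g h] | g in tadpoles n]|.

(* Main.v *)
(* Both sequences satisfy X_1 = 1 and
     X_(n+2) = sum_(i <= n) (2i+1) X_(i+1) X_(n-i+1),
   and symmetrizing this sum under i <-> n-i gives the differential equation.

   Tadpoles.  A tadpole has no automorphisms, so one may count labelled graphs.
   Fermion edges lie on fermion cycles, hence only boson edges can be bridges,
   and 1PI means that every union of fermion cycles avoiding the external leg
   is left by at least two boson edges.  Smoothing the vertex of the external
   leg gives a bridgeless graph without legs, with a marked vertex u.  Open the
   boson edge from u to w and let S be the least union of fermion cycles that
   contains u and is left by at most one further boson edge u'-w'; it exists
   because cut functions are submodular.  S with legs u and u' is a tadpole
   rooted at u with a leg inserted on one of its 2i+1 fermion edges, and the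
   rest, closed by an edge w-w', is again a bridgeless graph marked at w.

   Chord diagrams.  A diagram is connected iff no nonempty interval of points
   avoiding the first point 0 is a union of chords.  Let B be the largest
   interval avoiding the points 0, 1 and the last one such that {0} U B is a
   union of chords.  Then {0} U B and its complement are connected
   diagrams, and B can be placed in any of the 2i+1 inner gaps of the
   complement. *)

(* Isomorphism classes are awkward to cut and glue, labelled graphs are not. If t_m counts the
   labelled tadpoles with m vertices besides a prescribed root, trivial automorphism groups give
   t_(2n) = (2n)! T_(n+1). The pieces of a labelled graph are chosen by binomial coefficients, and
   after division by factorials only the factor 2i+1 survives.

   An extremal choice makes both decompositions unique, and it is exactly what the pieces need. For
   graphs, minimality of the cut S makes S with its two legs 1PI, and conversely a 1PI piece S is
   again the least cut after gluing. For chord diagrams, maximality of B makes the complement of {0}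
   U B connected, and conversely.

   The pieces live on subsets of the vertices or points. Hence all of them are encoded in one
   ambient type by permutations that are trivial outside the piece, and their number is shown to
   depend only on the size of the piece. *)
Require Import Defs.
From mathcomp Require Import all_boot all_fingroup.
From mathcomp Require Import zify ring.
Set Implicit Arguments. Unset Strict Implicit. Unset Printing Implicit Defensive.

(** * Finite sets and permutations *)

Lemma card_in_bij (A B : finType) (P : {set A}) (Q : {set B})
    (f : A -> B) (g : B -> A) :
  (forall x, x \in P -> f x \in Q) -> (forall y, y \in Q -> g y \in P) ->
  {in P, cancel f g} -> {in Q, cancel g f} -> #|P| = #|Q|.
Proof.
move=> fPQ gQP fK gK; rewrite -(card_in_imset (can_in_inj fK)).
apply: eq_card => y; apply/imsetP/idP => [[x xP ->]|yQ]; first exact: fPQ.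
by exists (g y); [exact: gQP | rewrite gK].
Qed.

(** The fibre over [y] is given by a relation, because the element of [Q] attached to [x] is often
    only known to exist uniquely, as for least cuts. *)
Lemma card_fibers (A B : finType) (P : {set A}) (Q : {set B}) (r : A -> B -> bool) :
  (forall x, x \in P -> exists2 y, y \in Q & forall z, z \in Q -> r x z = (z == y)) ->
  #|P| = \sum_(y in Q) #|[set x in P | r x y]|.
Proof.
move=> rP; under eq_bigr => y _ do rewrite -sum1dep_card.
under eq_bigr => y _ do rewrite big_mkcondr /=.
rewrite exchange_big /= -sum1_card; apply: eq_bigr => x xP.
have [y yQ ry] := rP x xP.
rewrite (bigD1 y) //= ry // eqxx big1 // => z /andP[zQ zy].
by rewrite ry // (negbTE zy).
Qed.

Section Perms.
Variable X : finType.
Implicit Types (s b : {perm X}) (K R S : {set X}).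

(* The identity if [f] is not injective. *)
Definition perm_fun (f : X -> X) : {perm X} := insubd (1%g : {perm X}) [ffun x => f x].

Lemma perm_funE f : injective f -> perm_fun f =1 f.
Proof.
move=> f_inj x; rewrite /perm_fun /insubd insubT /=.
  by apply/injectiveP => y z; rewrite !ffunE => /f_inj.
by move=> Hp; rewrite -pvalE /= ffunE.
Qed.

Definition stable s R := [forall x in R, s x \in R].

Lemma stableP s R : reflect {in R, forall x, s x \in R} (stable s R).
Proof. exact: forall_inP. Qed.

Lemma stableE s R x : stable s R -> (s x \in R) = (x \in R).
Proof.
move=> /stableP sR; have: s @: R == R.
  rewrite eqEcard card_imset ?leqnn ?andbT; last exact: perm_inj.
  by apply/subsetP=> _ /imsetP[y yR ->]; exact: sR.
by move/eqP=> {1}<-; rewrite mem_imset //; exact: perm_inj.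
Qed.

Lemma stable_eq s R : (forall x, (s x \in R) = (x \in R)) -> stable s R.
Proof. by move=> h; apply/stableP=> x; rewrite h. Qed.

Lemma stableI s R S : stable s R -> stable s S -> stable s (R :&: S).
Proof. by move=> hR hS; apply: stable_eq => x; rewrite !inE !stableE. Qed.

Lemma stableU s R S : stable s R -> stable s S -> stable s (R :|: S).
Proof. by move=> hR hS; apply: stable_eq => x; rewrite !inE !stableE. Qed.

Lemma stableD s R S : stable s R -> stable s S -> stable s (R :\: S).
Proof. by move=> hR hS; apply: stable_eq => x; rewrite !inE !stableE. Qed.

Lemma perm_on_stable s K : perm_on K s -> stable s K.
Proof. by move=> h; apply: stable_eq => x; rewrite perm_closed. Qed.

Lemma perm_onP s K : reflect (forall x, x \notin K -> s x = x) (perm_on K s).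
Proof.
apply: (iffP idP) => [h x|h]; first exact: out_perm.
by apply/subsetP=> x; rewrite inE; apply: contraNT => /h ->.
Qed.

(* Junk unless [K] is [s]-stable. *)
Definition restr K s := perm_fun (fun x => if x \in K then s x else x).

Lemma restrE K s x : stable s K -> restr K s x = if x \in K then s x else x.
Proof.
move=> sK; rewrite perm_funE // => y z.
case: ifP => yK; case: ifP => zK // e; first exact: (perm_inj e).
- by move: yK; rewrite -(stableE _ sK) e zK.
- by move: zK; rewrite -(stableE _ sK) -e yK.
Qed.

Lemma restr_on K s : stable s K -> perm_on K (restr K s).
Proof. by move=> sK; apply/perm_onP=> x xK; rewrite restrE // (negbTE xK). Qed.

Definition invol b := [forall x, b (b x) == x].

Lemma involP b : reflect (forall x, b (b x) = x) (invol b).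
Proof. by apply: (iffP forallP) => h x; apply/eqP. Qed.

Definition out b R := [set x in R | b x \notin R].

(** Submodularity holds vertex by vertex: the contribution of [x] depends only on which of [R] and
    [S] contain [x] and [b x]. *)
Lemma out_submod b R S :
  #|out b (R :&: S)| + #|out b (R :|: S)| <= #|out b R| + #|out b S|.
Proof.
have E T : #|out b T| = \sum_x ((x \in T) && (b x \notin T)).
  by rewrite -sum1dep_card big_mkcond; apply: eq_bigr => x _; case: ifP.
rewrite !E -!big_split; apply: leq_sum => x _ /=; rewrite !inE.
move: (x \in R) (x \in S) (b x \in R) (b x \in S); by do 4!case.
Qed.

(** [b] exchanges the two ends of each edge between [R] and its complement in [K]. *)
Lemma out_setD b K R : invol b -> stable b K -> R \subset K ->
  #|out b (K :\: R)| = #|out b R|.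
Proof.
move=> /involP bI bK /subsetP RK.
have bE x : (b x \in K) = (x \in K) by exact: stableE.
rewrite -(card_imset _ (@perm_inj _ b)); apply: eq_card => x.
apply/imsetP/idP => [[y]|].
  by rewrite !inE bE => /andP[/andP[yR yK] byR] ->; move: byR; rewrite yK andbT negbK bI yR => ->.
rewrite !inE => /andP[xR bxR]; exists (b x); last by rewrite bI.
by rewrite !inE bI xR bE RK // bxR.
Qed.

End Perms.

Lemma card_inj_preim (A B : finType) (f : A -> B) (P : {set A}) (Q : {set B}) :
  injective f -> (forall x, (f x \in Q) = (x \in P)) ->
  (forall y, y \in Q -> exists x, y = f x) -> #|Q| = #|P|.
Proof.
move=> f_inj fPQ fsurj; rewrite -(card_imset _ f_inj); apply: eq_card => y.
apply/idP/imsetP => [yQ|[x xP ->]]; last by rewrite fPQ.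
by have [x yx] := fsurj y yQ; exists x => //; rewrite -fPQ -yx.
Qed.

(** * Transport of permutations along an injection *)

Section Lift.
Variables (Y X : finType) (h : Y -> X).
Hypothesis h_inj : injective h.
Implicit Types (s b : {perm Y}) (K R S F : {set Y}).

Definition lift_fun s x := if [pick y | h y == x] is Some y then h (s y) else x.

Lemma lift_funE s y : lift_fun s (h y) = h (s y).
Proof.
rewrite /lift_fun; case: pickP => [z /eqP/h_inj -> //|/(_ y)].
by rewrite eqxx.
Qed.

Lemma lift_fun_out s x : (forall y, x != h y) -> lift_fun s x = x.
Proof.
move=> xh; rewrite /lift_fun; case: pickP => [z|//].
by rewrite eq_sym (negbTE (xh z)).
Qed.

Lemma lift_caseP x : (exists y, x = h y) \/ (forall y, x != h y).
Proof.
case: (pickP (fun y => x == h y)) => [y /eqP ->|hx]; first by left; exists y.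
by right=> y; rewrite hx.
Qed.

Lemma lift_fun_inj s : injective (lift_fun s).
Proof.
move=> x z; case: (lift_caseP x) => [[y ->]|xh]; case: (lift_caseP z) => [[t ->]|zh].
- by rewrite !lift_funE => /h_inj/perm_inj ->.
- by rewrite lift_funE (lift_fun_out _ zh) => e; case/eqP: (zh (s y)).
- by rewrite lift_funE (lift_fun_out _ xh) => e; case/eqP: (xh (s t)).
- by rewrite !lift_fun_out.
Qed.

Definition plift s : {perm X} := perm_fun (lift_fun s).

Lemma pliftE s y : plift s (h y) = h (s y).
Proof. by rewrite perm_funE ?lift_funE //; exact: lift_fun_inj. Qed.

Lemma plift_out s x : (forall y, x != h y) -> plift s x = x.
Proof. by move=> xh; rewrite perm_funE ?lift_fun_out //; exact: lift_fun_inj. Qed.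

Lemma plift_inj : injective plift.
Proof. by move=> s t st; apply/permP=> y; apply: h_inj; rewrite -!pliftE st. Qed.

Lemma plift_surj (t : {perm X}) : perm_on (h @: setT) t -> exists s, t = plift s.
Proof.
move=> tP; pose g y := odflt y [pick z | h z == t (h y)].
have gE y : h (g y) = t (h y).
  rewrite /g; case: pickP => [z /eqP //|no].
  have: t (h y) \in h @: setT by rewrite (perm_closed _ tP) imset_f.
  by case/imsetP=> z _ e; move: (no z); rewrite e eqxx.
have g_inj : injective g.
  by move=> y z e; apply/h_inj/(@perm_inj _ t); rewrite -!gE e.
exists (perm_fun g); apply/permP=> x; case: (lift_caseP x) => [[y ->]|xh].
  by rewrite pliftE perm_funE.
rewrite plift_out // (out_perm tP) //; apply/imsetP=> [[y _ xy]].
by case/eqP: (xh y).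
Qed.

Lemma imset_inE y R : (h y \in h @: R) = (y \in R).
Proof. exact: mem_imset. Qed.

Lemma plift_on K s : perm_on (h @: K) (plift s) = perm_on K s.
Proof.
apply/perm_onP/perm_onP=> hs x xK.
  by apply: h_inj; rewrite -pliftE hs // imset_inE.
case: (lift_caseP x) xK => [[y ->]|xh _]; last exact: plift_out.
by rewrite imset_inE pliftE => /hs ->.
Qed.

Lemma plift_invol b : invol (plift b) = invol b.
Proof.
apply/involP/involP=> hb x; first by apply: h_inj; rewrite -!pliftE hb.
case: (lift_caseP x) => [[y ->]|xh]; first by rewrite !pliftE hb.
by rewrite !plift_out // plift_out.
Qed.

Lemma plift_fix b K :
  [set x in h @: K | plift b x == x] = h @: [set x in K | b x == x].
Proof.
apply/setP=> x; case: (lift_caseP x) => [[y ->]|xh].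
  by rewrite imset_inE !inE imset_inE pliftE (inj_eq h_inj).
rewrite inE; apply/idP/idP=> [/andP[]|] /imsetP[y _ xy];
by case/eqP: (xh y).
Qed.

Lemma plift_stable s R : stable (plift s) (h @: R) = stable s R.
Proof.
apply/stableP/stableP=> hs x; first by move=> xR; rewrite -imset_inE -pliftE hs ?imset_inE.
by case/imsetP=> y yR ->; rewrite pliftE imset_inE hs.
Qed.

Lemma plift_card_out b R : #|out (plift b) (h @: R)| = #|out b R|.
Proof.
rewrite -[RHS](card_imset _ h_inj); apply: eq_card => x.
case: (lift_caseP x) => [[y ->]|xh].
  by rewrite imset_inE !inE pliftE !imset_inE.
rewrite inE; apply/idP/idP=> [/andP[]|] /imsetP[y _ xy];
by case/eqP: (xh y).
Qed.

Lemma sub_imsetK (R : {set X}) K : R \subset h @: K -> R = h @: (h @^-1: R).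
Proof.
move=> /subsetP RK; apply/setP=> x; apply/idP/imsetP=> [xR|[y + ->]]; last by rewrite inE.
by case/imsetP: (RK x xR) => y yK xy; exists y => //; rewrite inE -xy.
Qed.

End Lift.

(** * Rooted 1PI graphs *)

Section Structures.
Variable X : finType.
Implicit Types (s b : {perm X}) (K R S F : {set X}) (u v w r : X).

(* The fixed points of [b] are legs and do not contribute to [out b R]. *)
Definition sound s b K u :=
  [forall R : {set X},
     [&& R \subset K, u \notin R, R != set0 & stable s R] ==> (1 < #|out b R|)].

Lemma soundP s b K u :
  reflect (forall R : {set X}, R \subset K -> u \notin R -> R != set0 ->
             stable s R -> 1 < #|out b R|) (sound s b K u).
Proof.
apply: (iffP forallP) => [hR R RK uR R0 sR|hR R].
  by have /implyP := hR R; apply; apply/and4P.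
by apply/implyP=> /and4P[]; exact: hR.
Qed.

(* Graphs with vertex set [K] and set of boson legs [F], encoded by permutations
   of the ambient type that are trivial outside [K]. *)
Definition rooted_1PI K u F : {set {perm X} * {perm X}} :=
  [set g | [&& perm_on K g.1, perm_on K g.2, invol g.2,
               [set x in K | g.2 x == x] == F & sound g.1 g.2 K u]].

Lemma rooted_1PIP K u F s b :
  reflect [/\ perm_on K s, perm_on K b, invol b,
              [set x in K | b x == x] = F & sound s b K u] ((s, b) \in rooted_1PI K u F).
Proof.
rewrite inE /=; apply: (iffP and5P) => [[-> -> -> /eqP-> ->]//|[-> -> -> -> ->]].
by rewrite eqxx.
Qed.

End Structures.

Lemma plift_sound (Y X : finType) (h : Y -> X) (s b : {perm Y}) (K : {set Y}) u :
  injective h -> sound (plift h s) (plift h b) (h @: K) (h u) = sound s b K u.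
Proof.
move=> h_inj; apply/soundP/soundP=> hR R RK uR R0 sR.
  rewrite -(plift_card_out h_inj); apply: hR; first exact: imsetS.
  - by rewrite imset_inE.
  - by have /set0Pn[y yR] := R0; apply/set0Pn; exists (h y); rewrite imset_inE.
  - by rewrite plift_stable.
have RE := sub_imsetK RK; rewrite RE plift_card_out //; apply: hR.
- by apply/subsetP=> y; rewrite inE => /(subsetP RK); rewrite imset_inE.
- by rewrite inE.
- have /set0Pn[y yR] := R0; have: y \in h @: (h @^-1: R) by rewrite -RE.
  by case/imsetP=> z zR _; apply/set0Pn; exists z.
- by rewrite -(plift_stable h_inj) -RE.
Qed.

Lemma plift_rooted_1PI (Y X : finType) (h : Y -> X) (K : {set Y}) u (F : {set Y}) s b :
  injective h ->
  ((plift h s, plift h b) \in rooted_1PI (h @: K) (h u) (h @: F)) = ((s, b) \in rooted_1PI K u F).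
Proof.
move=> h_inj; rewrite !inE /= !plift_on // plift_invol // plift_sound //.
by rewrite plift_fix // (inj_eq (imset_inj h_inj)).
Qed.

Lemma card_rooted_1PI_imset (Y X : finType) (h : Y -> X) (K : {set Y}) u (F : {set Y}) : injective h ->
  #|rooted_1PI (h @: K) (h u) (h @: F)| = #|rooted_1PI K u F|.
Proof.
move=> h_inj; apply: (@card_inj_preim _ _ (fun g => (plift h g.1, plift h g.2))).
- by move=> [s b] [s' b'] /= [/(plift_inj h_inj)-> /(plift_inj h_inj)->].
- by move=> [s b] /=; exact: plift_rooted_1PI.
move=> [s b] /rooted_1PIP[sK bK _ _ _].
have onT t : perm_on (h @: K) t -> perm_on (h @: setT) t.
  by move=> tK; apply: subset_trans tK _; apply: imsetS; exact: subsetT.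
have [s' ->] := plift_surj h_inj (onT _ sK).
have [b' ->] := plift_surj h_inj (onT _ bK).
by exists (s', b').
Qed.

Lemma ord_enumeration (X : finType) (K : {set X}) u m : u \in K -> #|K| = m.+1 ->
  exists2 h : 'I_m.+1 -> X, injective h & h @: setT = K /\ h ord0 = u.
Proof.
move=> uK Km; pose e (i : 'I_m.+1) := enum_val (cast_ord (esym Km) i).
have e_inj : injective e by move=> i j /enum_val_inj/cast_ord_inj.
(* The transposition moves [u] to index 0; the order of the other vertices is irrelevant for
   graphs. *)
exists (fun i => tperm (e ord0) u (e i)); first by move=> i j /perm_inj/e_inj.
have eK i : e i \in K by exact: enum_valP.
rewrite tpermL; split=> //; apply/eqP; rewrite eqEcard; apply/andP; split.
  by apply/subsetP=> _ /imsetP[i _ ->]; case: tpermP => // _; exact: eK.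
rewrite card_imset ?cardsT ?card_ord ?Km // => i j /perm_inj; exact: e_inj.
Qed.

(** The index [m] is the number of vertices besides the root; a vacuum graph is one without legs. *)
Definition rooted_tadpole_count m := #|@rooted_1PI 'I_m.+1 setT ord0 [set ord0]|.
Definition rooted_vacuum_count m := #|@rooted_1PI 'I_m.+1 setT ord0 set0|.

Lemma card_rooted_tadpoles (X : finType) (K : {set X}) u m : u \in K -> #|K| = m.+1 ->
  #|rooted_1PI K u [set u]| = rooted_tadpole_count m.
Proof.
move=> uK Km; have [h h_inj [<- <-]] := ord_enumeration uK Km.
by rewrite -imset_set1 card_rooted_1PI_imset.
Qed.

Lemma card_rooted_vacua (X : finType) (K : {set X}) u m : u \in K -> #|K| = m.+1 ->
  #|rooted_1PI K u set0| = rooted_vacuum_count m.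
Proof.
move=> uK Km; have [h h_inj [<- <-]] := ord_enumeration uK Km.
by rewrite -(imset0 h) card_rooted_1PI_imset.
Qed.

(** * Smoothing the vertex of a leg *)

Section Smoothing.
Variable X : finType.
Implicit Types (s b : {perm X}) (K R S F : {set X}) (u v w r x y : X).

Lemma perm_onU1 K v s : perm_on (v |: K) s -> s v = v -> perm_on K s.
Proof.
move=> /perm_onP sK sv; apply/perm_onP=> x xK.
by have [->//|xv] := eqVneq x v; apply: sK; rewrite !inE negb_or xv.
Qed.

Lemma perm_on_sub K R s : K \subset R -> perm_on K s -> perm_on R s.
Proof. by move=> KR /subset_trans; apply. Qed.

Lemma fixU1 b K F v : v \notin K -> F \subset K -> b v = v ->
  ([set x in v |: K | b x == x] == v |: F) = ([set x in K | b x == x] == F).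
Proof.
move=> vK /subsetP FK bv; apply/eqP/eqP=> /setP h; apply/setP=> x; move: (h x);
  rewrite !inE; have [->|xv //] := eqVneq x v; rewrite bv eqxx ?(negbTE vK) //=.
by move=> _; apply/esym/negP=> /FK; rewrite (negbTE vK).
Qed.

Section Insert.
Variables (K F : {set X}) (v r x : X) (s b : {perm X}).
Hypotheses (vK : v \notin K) (rK : r \in v |: K) (xK : x \in K).
Hypotheses (sK : perm_on K s) (bK : perm_on K b).
(* [s'] is [s] with [v] inserted right after [x] in its cycle. *)
Let s' := (tperm v x * s)%g.
Let r' := if r == v then x else r.

Let xv : x != v. Proof. by apply: contraNneq vK => <-. Qed.
Let sv : s v = v. Proof. exact: (out_perm sK). Qed.
Let bv : b v = v. Proof. exact: (out_perm bK). Qed.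

Let bvE y : (b y == v) = (y == v).
Proof. by rewrite -[X in _ == X]bv (inj_eq perm_inj). Qed.

Let stable_ins R : stable s' R = stable s (R :\ v) && ((v \in R) == (x \in R)).
Proof.
have sE y : s' y = s (tperm v x y) by rewrite permM.
apply/idP/andP=> [sR|[sR /eqP vx]].
  have vx : (v \in R) = (x \in R) by rewrite -(stableE x sR) sE tpermR sv.
  split; last by rewrite vx.
  apply/stableP=> y; rewrite !inE => /andP[yv yR].
  have -> : s y != v by rewrite -[X in _ != X]sv (inj_eq perm_inj).
  have [yx|yx] := eqVneq y x.
    have <- : s' v = s y by rewrite sE tpermL yx.
    by rewrite stableE // vx -yx.
  have <- : s' y = s y by rewrite sE tpermD // eq_sym.
  by rewrite stableE.
apply/stableP=> y yR; rewrite sE.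
have hs z : z \in R -> z != v -> s z \in R.
  move=> zR zv; have: s z \in R :\ v by rewrite stableE // !inE zv.
  by rewrite !inE => /andP[].
case: tpermP => [yv|yx|yv _]; first by apply: hs; rewrite // -vx -yv.
  by rewrite sv vx -yx.
by apply: hs => //; apply/eqP.
Qed.

(** Stable sets of the two graphs correspond by putting [v] on the side of [x]. The leg at [v] never
    counts in [out], so corresponding sets are left by equally many edges. If [v] was the root, [x]
    takes over. *)
Lemma sound_insert : sound s' b (v |: K) r = sound s b K r'.
Proof.
apply/soundP/soundP=> hR R RK rR R0 sR.
  have vR : v \notin R by apply: contra vK; exact: (subsetP RK).
  pose R1 := if x \in R then v |: R else R.
  have R1E y : (y \in R1) = ((y == v) && (x \in R)) || (y \in R).
    by rewrite /R1; case: ifP; rewrite ?inE ?andbT ?andbF.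
  have ->: #|out b R| = #|out b R1|.
    apply: eq_card => y; rewrite !inE !R1E.
    have [->|yv] := eqVneq y v; first by rewrite bv eqxx (negbTE vR) /= orbF andbN.
    by rewrite bvE (negbTE yv) /=.
  apply: hR.
  - apply/subsetP=> y; rewrite R1E !inE => /orP[/andP[->//]|/(subsetP RK)->].
    by rewrite orbT.
  - move: rR; rewrite /r' R1E; have [->|_] := eqVneq r v; last by [].
    by rewrite (negbTE vR) orbF.
  - have /set0Pn[y yR] := R0; apply/set0Pn; exists y; by rewrite R1E yR orbT.
  - rewrite stable_ins !R1E eqxx (negbTE xv) (negbTE vR) orbF eqxx andbT.
    suff -> : R1 :\ v = R by [].
    apply/setP=> y; rewrite !inE R1E; have [->|//] := eqVneq y v.
    by rewrite (negbTE vR).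
move: sR; rewrite stable_ins => /andP[sR /eqP vx].
have ->: #|out b R| = #|out b (R :\ v)|.
  apply: eq_card => y; rewrite !inE.
  have [->|yv] := eqVneq y v; first by rewrite bv andbN.
  by rewrite bvE (negbTE yv).
apply: hR => //.
- by apply/subsetP=> y; rewrite !inE => /andP[yv /(subsetP RK)]; rewrite !inE (negbTE yv).
- rewrite /r' !inE; have [e|rv] := eqVneq r v; last by rewrite (negbTE rR) andbF.
  by rewrite -vx -e (negbTE rR) andbF.
have /set0Pn[y yR] := R0; apply/set0Pn; have [e|yv] := eqVneq y v.
  by exists x; rewrite !inE xv -vx -e yR.
by exists y; rewrite !inE yv.
Qed.

End Insert.

(** Otherwise [v] would be a component of its own, and whichever of [{v}] and [K] avoids the root
    would be left by no edge. *)
Lemma leg_not_fixed K F v r s b : v \notin K -> r \in v |: K -> K != set0 ->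
  (s, b) \in rooted_1PI (v |: K) r (v |: F) -> s v != v.
Proof.
move=> vK rK K0 /rooted_1PIP[sK bK _ bF /soundP hs]; apply/eqP => sv.
have bv : b v = v.
  by have := set11 v; move/setP/(_ v): bF; rewrite !inE eqxx /= => /eqP.
pose R := if r == v then K else [set v].
have vR : (v \in R) = (r != v) by rewrite /R; case: eqP; rewrite ?(negbTE vK) ?inE ?eqxx.
have: 1 < #|out b R|; last first.
  suff -> : out b R = set0 by rewrite cards0.
  apply/setP=> y; rewrite !inE /R; case: ifP => _.
    by rewrite (perm_closed _ (perm_onU1 bK bv)) andbN.
  by rewrite !inE; case: eqP => // ->; rewrite bv eqxx.
apply: hs; rewrite /R; have [e|rv] := eqVneq r v.
- exact: subsetUr.
- by rewrite sub1set setU11.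
- by rewrite e.
- by rewrite inE.
- by [].
- by apply/set0Pn; exists v; rewrite inE.
- exact: perm_on_stable (perm_onU1 sK sv).
- by apply/stableP=> y; rewrite !inE => /eqP ->; rewrite sv.
Qed.

(** The summation index [x] is the predecessor of [v] on its fermion cycle: it names the fermion
    edge of the smoothed graph that carried the leg. *)
Lemma card_smooth_leg K F v r : v \notin K -> r \in v |: K -> F \subset K ->
    K != set0 ->
  #|rooted_1PI (v |: K) r (v |: F)|
    = \sum_(x in K) #|rooted_1PI K (if r == v then x else r) F|.
Proof.
move=> vK rK FK K0.
rewrite (@card_fibers _ _ _ K (fun (g : {perm X} * {perm X}) x => g.1 x == v)); last first.
  move=> [s b] gS; have sv := leg_not_fixed vK rK K0 gS.
  have [sK _ _ _ _] := rooted_1PIP _ _ _ _ _ gS.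
  exists (s^-1%g v) => [|z _]; last by rewrite -[z == _](inj_eq (@perm_inj _ s)) permKV.
  have: s (s^-1%g v) \in v |: K by rewrite permKV setU11.
  rewrite (perm_closed _ sK) !inE => /orP[/eqP e|//].
  by case/eqP: sv; rewrite -{1}e permKV.
apply: eq_bigr => x xK.
have xv : x != v by apply: contraNneq vK => <-.
(* The same transposition removes [v] from its cycle and inserts it after [x], so [f] is its own
   inverse. *)
pose f g : {perm X} * {perm X} := ((tperm v x * g.1)%g, g.2).
have fK g : f (f g) = g by case: g => s b; rewrite /f /= mulgA tperm2 mul1g.
apply: (@card_in_bij _ _ _ _ f f) => [[s b]|[s b]|g _|g _]; rewrite ?fK //.
- rewrite inE => /andP[/rooted_1PIP[sK bK bI bF bS] /= /eqP sx].
  have bv : b v = v.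
    by have := set11 v; move/setP/(_ v): bF; rewrite !inE eqxx /= => /eqP.
  have s'K : perm_on K (tperm v x * s)%g.
    apply/perm_onP=> y yK; rewrite permM; have [->|yv] := eqVneq y v.
      by rewrite tpermL.
    have yx : y != x by apply: contraNneq yK => ->.
    rewrite tpermD 1?eq_sym //; apply: (out_perm sK).
    by rewrite !inE negb_or yv.
  have b'K := perm_onU1 bK bv.
  rewrite /f /=; apply/rooted_1PIP; split=> //.
    by apply/eqP; rewrite -(fixU1 vK FK bv) bF.
  rewrite -(@sound_insert K v r x) //.
  by rewrite mulgA tperm2 mul1g.
move=> /rooted_1PIP[sK bK bI bF bS] /=.
have bv := out_perm bK vK.
rewrite /f inE /= permM tpermR (out_perm sK vK) eqxx andbT.
have KV : K \subset v |: K := subsetUr _ _.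
apply/rooted_1PIP; split=> //; last by rewrite sound_insert.
- apply: perm_onM; last exact: perm_on_sub sK.
  apply: perm_on_sub (tperm_on v x).
  by rewrite subUset !sub1set setU11 !inE xK orbT.
- exact: perm_on_sub bK.
- by apply/eqP; rewrite fixU1 // bF.
Qed.

(** Smoothing the leg at [w] leaves a tadpole with m+1 vertices, hence m+1 fermion edges on which
    the leg may have been. *)
Lemma card_two_legs K u w m : u \in K -> w \in K -> w != u -> #|K| = m.+2 ->
  #|rooted_1PI K u [set u; w]| = m.+1 * rooted_tadpole_count m.
Proof.
move=> uK wK wu Km.
have KE : K = w |: (K :\ w) by rewrite setD1K.
have uK' : u \in K :\ w by rewrite !inE eq_sym wu.
have Km' : #|K :\ w| = m.+1 by move: Km; rewrite (cardsD1 w) wK => -[].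
rewrite {1}KE [[set u; w]]setUC card_smooth_leg ?sub1set ?setD11 //.
- rewrite eq_sym (negbTE wu) sum_nat_const Km'.
  by rewrite (@card_rooted_tadpoles _ _ _ m).
- by rewrite setD1K.
- by apply/set0Pn; exists u.
Qed.

End Smoothing.

Lemma rooted_tadpole_count0 : rooted_tadpole_count 0 = 1.
Proof.
rewrite /rooted_tadpole_count; apply/eqP/cards1P; exists (1%g, 1%g); apply/setP=> -[s b].
rewrite inE; apply/rooted_1PIP/eqP => [_|[-> ->]].
  by congr pair; apply/permP=> i; rewrite !ord1.
split; rewrite ?perm_on1 //; first by apply/involP=> i; rewrite !perm1.
  by apply/setP=> i; rewrite !inE perm1 ord1 !eqxx.
apply/soundP=> R _ R0 /set0Pn[i]; rewrite ord1 => i0.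
by rewrite i0 in R0.
Qed.

(** Smoothing the root's own leg passes the mark to the predecessor of the root, which can be any of
    the m+1 remaining vertices. *)
Lemma rooted_tadpole_countS m : rooted_tadpole_count m.+1 = m.+1 * rooted_vacuum_count m.
Proof.
rewrite /rooted_tadpole_count; pose K := [set~ ord0 : 'I_m.+2].
have KE : [set: 'I_m.+2] = ord0 |: K by apply/setP=> i; rewrite !inE orbN.
have cK : #|K| = m.+1 by rewrite cardsC1 card_ord.
rewrite KE -[X in rooted_1PI _ _ X]setU0 card_smooth_leg ?sub0set ?setU11 //.
- rewrite eqxx -[X in X * _]cK -sum_nat_const; apply: eq_bigr => x xK.
  exact: card_rooted_vacua.
- by rewrite !inE eqxx.
- by rewrite -card_gt0 cK.
Qed.

(** * Cutting a graph along two boson edges *)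

Section Cutting.
Variable X : finType.
Implicit Types (s b : {perm X}) (K R S T F : {set X}) (u v w r x y : X).

(** If [R] contains the root, its complement in [K] does not, and the same boson edges leave
    both. *)
Lemma sound_proper s b K u R : perm_on K s -> perm_on K b -> invol b ->
  sound s b K u -> R \subset K -> R != set0 -> R != K -> stable s R ->
  1 < #|out b R|.
Proof.
move=> sK bK bI /soundP hs RK R0 RnK sR.
have [uR|uR] := boolP (u \in R); last exact: hs.
rewrite -(@out_setD _ b K) //; last exact: perm_on_stable.
apply: hs; rewrite ?subsetDl ?inE ?uR //.
  by rewrite setD_eq0; apply: contra RnK => KR; rewrite eqEsubset RK.
by apply: stableD => //; exact: perm_on_stable.
Qed.

(* [(s, b)] on [K] is cut into [(s1, b1)] on [S], with legs [u] and [u'], and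
   [(s2, b2)] on [T], where the two edges [u]-[w] and [u']-[w'] between [S] and
   [T] are replaced by an edge [w]-[w']. *)
Section Compat.
Variables (K S T : {set X}) (u u' w w' : X) (s s1 s2 b b1 b2 : {perm X}).
Hypotheses (TE : T = K :\: S) (SK : S \subset K).
Hypotheses (uS : u \in S) (u'S : u' \in S) (wT : w \in T) (w'T : w' \in T).
Hypotheses (ww' : w' != w).
Hypotheses (s1S : perm_on S s1) (s2T : perm_on T s2).
Hypotheses (ss1 : {in S, s1 =1 s}) (ss2 : {in T, s2 =1 s}).
Hypotheses (b1S : perm_on S b1) (b2T : perm_on T b2).
Hypotheses (bI : invol b) (b1I : invol b1) (b2I : invol b2).
Hypotheses (bu : b u = w) (bu' : b u' = w').
Hypotheses (b1u : b1 u = u) (b1u' : b1 u' = u') (b2w : b2 w = w').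
Hypotheses (bb1 : forall x, x \in S -> x != u -> x != u' -> b x = b1 x)
           (bb2 : forall x, x \in T -> x != w -> x != w' -> b x = b2 x).

Let bw : b w = u. Proof. by rewrite -bu (involP _ bI). Qed.
Let bw' : b w' = u'. Proof. by rewrite -bu' (involP _ bI). Qed.
Let b2w' : b2 w' = w. Proof. by rewrite -b2w (involP _ b2I). Qed.
Let nS x : x \in T -> x \notin S. Proof. by rewrite TE inE => /andP[]. Qed.
Let TK : T \subset K. Proof. by rewrite TE subsetDl. Qed.
Let nT x : x \in S -> x \notin T. Proof. by move=> xS; rewrite TE inE xS. Qed.

Let stable1 R : R \subset S -> stable s1 R = stable s R.
Proof.
move=> /subsetP RS; apply/stableP/stableP=> h x xR; move: (h x xR).
  by rewrite ss1 ?RS.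
by rewrite ss1 ?RS.
Qed.

Let stable2 R : R \subset T -> stable s2 R = stable s R.
Proof.
move=> /subsetP RS; apply/stableP/stableP=> h x xR; move: (h x xR).
  by rewrite ss2 ?RS.
by rewrite ss2 ?RS.
Qed.

Let sS : stable s S. Proof. by rewrite -stable1 //; exact: perm_on_stable. Qed.
Let sT : stable s T. Proof. by rewrite -stable2 //; exact: perm_on_stable. Qed.

(** If [R] meets [S], the edges that leave its trace inside [S] also leave [R]. If [R] is [T], the
    two cut edges leave it. If [R] is a proper part of [T], replacing [w]-[w'] by edges into [S]
    loses no outgoing edge. *)
Lemma compat_sound : sound s1 b1 S u -> sound s2 b2 T w -> sound s b K u.
Proof.
move=> /soundP h1 h2; apply/soundP=> R RK uR R0 sR.
have [RS0|RS0] := eqVneq (R :&: S) set0; last first.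
  have sRS : stable s1 (R :&: S) by rewrite stable1 ?subsetIr //; exact: stableI.
  apply: leq_trans (h1 _ (subsetIr _ _) _ RS0 sRS) _.
    by rewrite inE (negbTE uR).
  apply: subset_leq_card; apply/subsetP=> x; rewrite !inE => /andP[/andP[xR xS] nbx].
  have b1xS : b1 x \in S by rewrite (perm_closed _ b1S).
  rewrite xR /= bb1 //; first by move: nbx; rewrite b1xS andbT.
    by apply: contraNneq uR => <-.
  by apply: contraNneq nbx => e; rewrite e b1u' -e xR.
have RT : R \subset T.
  apply/subsetP=> x xR; rewrite TE inE (subsetP RK) // andbT.
  by apply/negP=> xS; move/setP/(_ x): RS0; rewrite !inE xR xS.
have [RE|RnT] := eqVneq R T.
  suff sub : [set w; w'] \subset out b R.
    by have := subset_leq_card sub; rewrite cards2 eq_sym ww'.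
  by apply/subsetP=> x; rewrite !inE RE => /orP[]/eqP->;
     rewrite ?bw ?bw' ?wT ?w'T nT.
have := sound_proper s2T b2T b2I h2 RT R0 RnT.
rewrite stable2 // => /(_ sR) /leq_trans; apply; apply: subset_leq_card.
apply/subsetP=> x; rewrite !inE => /andP[xR nb]; rewrite xR /=.
have nR y : y \in S -> y \notin R by move=> /nT; apply: contra; exact: (subsetP RT).
have [->|xw] := eqVneq x w; first by rewrite bw nR.
have [->|xw'] := eqVneq x w'; first by rewrite bw' nR.
by rewrite bb2 // (subsetP RT).
Qed.

(** Two edges lead from [R] to the rest of [S] because the piece [S] is 1PI, and the edge at [u] is
    a third one. This is what makes [S] the least cut after gluing. *)
Lemma compat_minimal R : sound s1 b1 S u ->
  R \subset S -> u \in R -> stable s R -> R != S -> 2 < #|out b R|.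
Proof.
move=> /soundP h1 RS uR sR RnS.
have b1st := perm_on_stable b1S.
have h : 1 < #|out b1 R|.
  rewrite -(out_setD b1I b1st RS); apply: h1; rewrite ?subsetDl ?inE ?uR //.
    by rewrite setD_eq0; apply: contra RnS => SR; rewrite eqEsubset RS.
  by rewrite stable1 ?subsetDl //; exact: stableD.
have sub : u |: out b1 R \subset out b R.
  apply/subsetP=> x; rewrite !inE => /orP[/eqP->|/andP[xR nb]].
    by rewrite uR bu; apply: contra (nS wT); exact: (subsetP RS).
  rewrite xR bb1 ?(subsetP RS) //; apply: contraNneq nb => e; last by rewrite e b1u' -e.
  by rewrite e b1u.
apply: leq_trans (subset_leq_card sub).
by rewrite cardsU1 !inE b1u uR.
Qed.

(** If [R] avoids [u'], all its outgoing edges stay inside [S]. If [R] contains [u'], the set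
    [S :\: R] contains [u], so by minimality at least three edges leave it; only the one at [u]
    leads out of [S], and the others separate [R] from [S :\: R]. *)
Lemma compat_sound1 : sound s b K u ->
    (forall R, R \subset S -> u \in R -> stable s R -> R != S -> 2 < #|out b R|) ->
  sound s1 b1 S u.
Proof.
move=> /soundP h hmin; apply/soundP=> R RS uR R0; rewrite stable1 // => sR.
have [u'R|u'R] := boolP (u' \in R); last first.
  apply: leq_trans (h R _ uR R0 sR) _; first exact: subset_trans SK.
  apply: subset_leq_card; apply/subsetP=> x; rewrite !inE => /andP[xR nb].
  rewrite xR -bb1 // ?(subsetP RS) //; first by apply: contraNneq uR => <-.
  by apply: contraNneq u'R => <-.
have b1st := perm_on_stable b1S.
rewrite -(out_setD b1I b1st RS).
have hm : 2 < #|out b (S :\: R)|.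
  apply: hmin; rewrite ?subsetDl ?inE ?uR //; first exact: stableD.
  apply/eqP=> e; have : u' \in S :\: R by rewrite e; exact: u'S.
  by rewrite inE u'R.
have sub : out b (S :\: R) \subset u |: out b1 (S :\: R).
  apply/subsetP=> x; rewrite !inE => /andP[/andP[xR xS]].
  have [//|xu /=] := eqVneq x u.
  rewrite xR xS bb1 //; by apply: contraNneq xR => ->.
have := leq_trans hm (subset_leq_card sub).
by rewrite cardsU1; case: (_ \notin _) => [|/ltnW].
Qed.

(** [R] avoids [w], so the edge at [w'] leaves [R] both before and after its end in [S] is replaced
    by [w]. *)
Lemma compat_sound2 : sound s b K u -> sound s2 b2 T w.
Proof.
move=> /soundP h; apply/soundP=> R RT wR R0; rewrite stable2 // => sR.
have nR y : y \in S -> y \notin R by move=> /nT; apply: contra; exact: (subsetP RT).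
apply: leq_trans (h R _ (nR u uS) R0 sR) _; first exact: subset_trans TK.
apply: subset_leq_card; apply/subsetP=> x; rewrite !inE => /andP[xR nb].
rewrite xR /=; have [->|xw'] := eqVneq x w'; first by rewrite b2w'.
rewrite -bb2 // ?(subsetP RT) //; by apply: contraNneq wR => <-.
Qed.

End Compat.
End Cutting.

(** * Explicit cutting and gluing of boson involutions *)

Section Glue.
Variable X : finType.
Variables (K S : {set X}) (u u' w : X).
Hypotheses (SK : S \subset K) (uS : u \in S) (u'S : u' \in S) (uu' : u' != u).
Hypothesis (wT : w \in K :\: S).
Let T := K :\: S.

(** Here [b2 w] is the other end [w'] of the closing edge of the second piece; that edge is replaced
    by [u]-[w] and [u']-[w']. *)
Definition glue_fun (b1 b2 : {perm X}) x :=
  if x == u then w else if x == w then u else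
  if x == u' then b2 w else if x == b2 w then u' else
  if x \in S then b1 x else b2 x.

Definition cut1_fun (b : {perm X}) x := if (x \in S) && (b x \in S) then b x else x.

(** Here [b u'] is the end [w'] outside [S], and the new edge joins it to [w]. *)
Definition cut2_fun (b : {perm X}) x :=
  if x == w then b u' else if x == b u' then w else if x \in T then b x else x.

Let nS x : x \in T -> (x \in S) = false.
Proof. by rewrite !inE => /andP[/negbTE]. Qed.

Lemma glue_involutive (b1 b2 : {perm X}) : perm_on S b1 -> perm_on T b2 ->
    invol b1 -> invol b2 -> b1 u = u -> b1 u' = u' -> b2 w != w ->
  involutive (glue_fun b1 b2).
Proof.
move=> b1S b2T b1I b2I b1u b1u' b2w x.
have w'T : b2 w \in T by rewrite (perm_closed _ b2T).
have wS := nS wT; have w'S := nS w'T.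
have neS y z : y \in S -> z \in S = false -> (y == z) = false.
  by move=> yS zS; apply: contraFF zS => /eqP<-.
have wu := neS _ _ uS wS; have wu' := neS _ _ u'S wS.
have w'u := neS _ _ uS w'S; have w'u' := neS _ _ u'S w'S.
rewrite /glue_fun.
have [->|xu] := eqVneq x u; first by rewrite eq_sym wu eqxx.
have [->|xw] := eqVneq x w; first by rewrite eqxx.
have [->|xu'] := eqVneq x u'.
  by rewrite eq_sym w'u (negbTE b2w) eq_sym w'u' eqxx.
have [->|xw'] := eqVneq x (b2 w); first by rewrite (negbTE uu') wu' eqxx.
have [xS|xS] := boolP (x \in S).
  have bxS : b1 x \in S by rewrite (perm_closed _ b1S).
  rewrite -{1}b1u (inj_eq perm_inj) (negbTE xu) (neS _ _ bxS wS) -{1}b1u'.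
  by rewrite (inj_eq perm_inj) (negbTE xu') (neS _ _ bxS w'S) bxS (involP _ b1I).
have bxS : b2 x \in S = false.
  have [xT|xT] := boolP (x \in T); first by apply: nS; rewrite (perm_closed _ b2T).
  by rewrite (out_perm b2T xT) (negbTE xS).
rewrite (eq_sym _ u) (neS _ _ uS bxS) (eq_sym _ u') (neS _ _ u'S bxS).
rewrite (inj_eq perm_inj) (negbTE xw) bxS (involP _ b2I).
by rewrite -{1}[w](involP _ b2I) (inj_eq perm_inj) (negbTE xw').
Qed.

Variables (b : {perm X}).
Hypotheses (bK : perm_on K b) (bI : invol b).

Lemma cut1_involutive : involutive (cut1_fun b).
Proof.
move=> x; rewrite /cut1_fun.
case h: ((x \in S) && (b x \in S)); last by rewrite h.
by case/andP: h => xS bxS; rewrite bxS (involP _ bI) xS.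
Qed.

Hypotheses (bu : b u = w) (outE : out b S = [set u; u']).

Let u'out : u' \in out b S. Proof. by rewrite outE !inE eqxx orbT. Qed.

Lemma bu'T : b u' \in T.
Proof.
move: u'out; rewrite !inE => /andP[_ ->].
by rewrite (perm_closed _ bK) (subsetP SK).
Qed.

Lemma bT x : x \in T -> x != w -> x != b u' -> b x \in T.
Proof.
move=> xT xw xu'; rewrite inE (perm_closed _ bK) andbC.
have -> /= : x \in K by move: xT; rewrite inE => /andP[].
apply/negP=> bxS; have: b x \in out b S by rewrite inE bxS (involP _ bI) nS.
rewrite outE !inE -(inj_eq (@perm_inj _ b)) (involP _ bI) bu (negbTE xw).
by rewrite -(inj_eq (@perm_inj _ b)) (involP _ bI) (negbTE xu').
Qed.

Lemma cut2_involutive : involutive (cut2_fun b).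
Proof.
have u'w : b u' != w by rewrite -bu (inj_eq perm_inj).
move=> x; rewrite /cut2_fun.
have [->|xw] := eqVneq x w; first by rewrite (negbTE u'w) eqxx.
have [->|xu'] := eqVneq x (b u'); first by rewrite eqxx.
have [xT|xT] := boolP (x \in T); last by rewrite (negbTE xw) (negbTE xu') (negbTE xT).
have bxT := bT xT xw xu'; rewrite bxT (involP _ bI).
have neq y : y \in S -> (b x == y) = false.
  by move=> yS; apply: contraTF bxT => /eqP ->; rewrite inE yS.
rewrite -{1}bu (inj_eq perm_inj) (inj_eq perm_inj).
have xS : (x \in S) = false := nS xT.
case: eqP => [e|_]; first by rewrite e uS in xS.
by case: eqP => [e|_]; first by rewrite e u'S in xS.
Qed.

End Glue.

(** * Least cuts, and the case where the least cut is the whole graph *)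

Section LeastCut.
Variable X : finType.
Implicit Types (s b : {perm X}) (K R S T F : {set X}) (u v w r x y : X).
Implicit Types (g : {perm X} * {perm X}).

(* The disjunct [S == K] makes the family of cuts nonempty; the least cut is [K]
   when opening the boson edge at [u] creates no bridge. *)
Definition cut K u g S :=
  [&& u \in S, S \subset K, stable g.1 S &
      (S == K) || (g.2 u \notin S) && (#|out g.2 S| <= 2)].

Definition least_cut K u g S :=
  cut K u g S && [forall S' : {set X}, cut K u g S' ==> (S \subset S')].

Lemma least_cutP K u g S :
  reflect (cut K u g S /\ forall S', cut K u g S' -> S \subset S') (least_cut K u g S).
Proof.
apply: (iffP andP) => -[-> h]; split=> //.
  by move=> S'; have /forallP/(_ S')/implyP := h.
by apply/forallP=> S'; apply/implyP; exact: h.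
Qed.

(** The union of two cuts other than [K] still misses [b u], so it is proper and at least two edges
    leave it. Submodularity then leaves at most 2 + 2 - 2 edges for the intersection. *)
Lemma cutI K u g S S' : g \in rooted_1PI K u set0 ->
  cut K u g S -> cut K u g S' -> cut K u g (S :&: S').
Proof.
case: g => s b gK; have [sK bK bI bF bS] := rooted_1PIP _ _ _ _ _ gK.
rewrite /cut => /and4P[uS SK sS /orP[/eqP->|]].
  move=> /and4P[uS' S'K sS' h]; have -> : K :&: S' = S' by apply/setIidPr.
  by rewrite uS' S'K sS'.
move=> /andP[buS oS] /and4P[uS' S'K sS' /orP[/eqP->|/andP[buS' oS']]].
  have -> : S :&: K = S by apply/setIidPl.
  by rewrite uS SK sS buS oS orbT.
rewrite /= in sS sS' buS buS' oS oS' *.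
have uI : u \in S :|: S' by rewrite inE uS.
have buK : b u \in K by rewrite (perm_closed _ bK) (subsetP SK).
have : 1 < #|out b (S :|: S')|.
  apply: (sound_proper sK bK bI bS); rewrite ?subUset ?SK ?stableU //.
    by apply/set0Pn; exists u.
  by apply: contraNneq buS => e; move: buK; rewrite -e inE (negbTE buS') orbF.
have := out_submod b S S'.
rewrite inE uS uS' /= subIset ?SK // stableI //= inE (negbTE buS) /=.
move=> h1 h2; apply/orP; right; move: h1 h2 oS oS'; clear.
by move: #|_| #|_| #|_| #|_|; lia.
Qed.

Lemma least_cut_exists K u g : g \in rooted_1PI K u set0 -> u \in K ->
  exists S, least_cut K u g S.
Proof.
move=> gK uK.
have cK : cut K u g K.
  case: g gK => s b /rooted_1PIP[sK _ _ _ _].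
  by rewrite /cut uK subxx eqxx /= perm_on_stable.
case: (arg_minnP (fun S : {set X} => #|S|) cK) => S cS hS.
exists S; apply/least_cutP; split=> // S' cS'.
have cI := cutI gK cS cS'.
have /eqP <- : S :&: S' == S by rewrite eqEcard subsetIl hS.
exact: subsetIr.
Qed.

Lemma least_cut_unique K u g S S' : least_cut K u g S -> least_cut K u g S' -> S = S'.
Proof.
move=> /least_cutP[c h] /least_cutP[c' h'].
by apply/eqP; rewrite eqEsubset h // h'.
Qed.

(** Minimal under inclusion implies least, since cuts are closed under intersection. *)
Lemma least_cut_minimal K u g S : g \in rooted_1PI K u set0 -> cut K u g S ->
  (forall S', S' \subset S -> cut K u g S' -> S' = S) -> least_cut K u g S.
Proof.
move=> gK cS h; apply/least_cutP; split=> // S' cS'.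
by rewrite -(h _ (subsetIl S S') (cutI gK cS cS')) subsetIr.
Qed.

Lemma card_vacua_least_cut K u : u \in K ->
  #|rooted_1PI K u set0| =
    \sum_(S : {set X} | (u \in S) && (S \subset K)) #|[set g in rooted_1PI K u set0 | least_cut K u g S]|.
Proof.
move=> uK; rewrite (@card_fibers _ _ _ [set S : {set X} | (u \in S) && (S \subset K)] (least_cut K u)).
  by apply: eq_bigl => S; rewrite inE.
move=> g gK; have [S lS] := least_cut_exists gK uK.
exists S; first by rewrite inE; case/andP: lS => /and4P[-> -> _ _].
move=> S' _; apply/idP/eqP => [lS'|->//]; exact: least_cut_unique lS' lS.
Qed.

Lemma vacuum_fixfree K u s b x : (s, b) \in rooted_1PI K u set0 -> x \in K -> b x != x.
Proof.
move=> /rooted_1PIP[_ _ _ /setP/(_ x) bF _] xK; move: bF.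
by rewrite !inE xK => /negbT.
Qed.

(** The least cut is [K] exactly when opening the boson edge from [u] to [w] creates no bridge, so
    that the opened graph is still 1PI, with legs at [u] and [w]. Multiplication by [tperm u w]
    opens the edge and joins the legs again. *)
Lemma card_least_full K u : u \in K ->
  #|[set g in rooted_1PI K u set0 | least_cut K u g K]|
    = \sum_(w in K :\ u) #|rooted_1PI K u [set u; w]|.
Proof.
move=> uK.
rewrite (@card_fibers _ _ _ (K :\ u) (fun (g : {perm X} * {perm X}) w => g.2 u == w)); last first.
  move=> [s b]; rewrite inE => /andP[gK _] /=; exists (b u); last by move=> z _; rewrite eq_sym.
  have [_ bK _ _ _] := rooted_1PIP _ _ _ _ _ gK.
  by rewrite !inE (vacuum_fixfree gK uK) (perm_closed _ bK).
apply: eq_bigr => w; rewrite !inE => /andP[wu wK].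
pose f g : {perm X} * {perm X} := (g.1, (tperm u w * g.2)%g).
have fK g : f (f g) = g by case: g => s b; rewrite /f /= mulgA tperm2 mul1g.
have tE (b : {perm X}) x : (tperm u w * b)%g x = b (tperm u w x) by rewrite permM.
apply: (@card_in_bij _ _ _ _ f f) => [[s b]|[s b]|g _|g _]; rewrite ?fK //.
- move=> /setIdP[/setIdP[gK /least_cutP[_ lK]] /= /eqP bu].
  have [sK bK bI bF /soundP bS] := rooted_1PIP _ _ _ _ _ gK.
  have bw : b w = u by rewrite -bu (involP _ bI).
  have bE x : x != u -> x != w -> b (tperm u w x) = b x.
    by move=> xu xw; rewrite tpermD // eq_sym.
  have bne x : x != u -> x != w -> (b x != u) && (b x != w).
    by move=> xu xw; rewrite -{1}bw -{2}bu !(inj_eq perm_inj) xu xw.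
  apply/rooted_1PIP; split=> //.
  + apply: perm_onM bK; apply: perm_on_sub (tperm_on u w).
    by rewrite subUset !sub1set uK.
  + apply/involP=> x; rewrite !tE.
    have [->|xu] := eqVneq x u; first by rewrite tpermL bw tpermL.
    have [->|xw] := eqVneq x w; first by rewrite tpermR bu tpermR.
    by have /andP[bxu bxw] := bne x xu xw; rewrite bE // bE // (involP _ bI).
  + apply/setP=> x; rewrite !inE tE.
    have [->|xu] := eqVneq x u; first by rewrite tpermL bw uK eqxx.
    have [->|xw] := eqVneq x w; first by rewrite tpermR bu wK eqxx.
    rewrite bE //=; apply/negP=> /andP[xK]; exact/negP/(vacuum_fixfree gK xK).
  apply/soundP=> R RK uR R0 sR.
  have [wR|wR] := boolP (w \in R); last first.
    have -> : out (tperm u w * b)%g R = out b R; last exact: bS.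
    apply/setP=> x; rewrite !inE tE; have [xR|//] := boolP (x \in R).
    by rewrite bE //; [apply: contraNneq uR => <- | apply: contraNneq wR => <-].
  (* If opening the edge made at most one edge leave [R], the complement of [R] would be a cut
     without [w], contradicting that [K] is least. *)
  have nc : ~~ cut K u (s, b) (K :\: R).
    apply/negP=> /lK /subsetP /(_ w wK); by rewrite inE wR.
  rewrite ltnNge; apply: contra nc => oR.
  apply/and4P; split; [by rewrite inE uR | exact: subsetDl | |].
    by apply: stableD => //; exact: perm_on_stable.
  apply/orP; right; rewrite /= bu inE wR /=.
  rewrite out_setD //; last exact: perm_on_stable.
  have sub : out b R \subset w |: out (tperm u w * b)%g R.
    apply/subsetP=> x; rewrite !inE tE => /andP[xR].
    have [//|xw /=] := eqVneq x w.
    by rewrite xR bE //; apply: contraNneq uR => <-.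
  apply: leq_trans (subset_leq_card sub) _; rewrite cardsU1.
  by rewrite -[2]/(1 + 1); apply: leq_add => //; case: (_ \notin _).
move=> gK; have [sK bK bI bF /soundP bS] := rooted_1PIP _ _ _ _ _ gK.
have bfix x : x \in K -> (b x == x) = (x == u) || (x == w).
  by move=> xK; move/setP/(_ x): bF; rewrite !inE xK.
have bu : b u = u by apply/eqP; rewrite bfix // eqxx.
have bw : b w = w by apply/eqP; rewrite bfix // eqxx orbT.
have bE x : x != u -> x != w -> b (tperm u w x) = b x.
  by move=> xu xw; rewrite tpermD // eq_sym.
have bne x : x != u -> x != w -> (b x != u) && (b x != w).
  by move=> xu xw; rewrite -{1}bu -{1}bw !(inj_eq perm_inj) xu xw.
have b'I : invol (tperm u w * b)%g.
  apply/involP=> x; rewrite !tE.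
  have [->|xu] := eqVneq x u; first by rewrite tpermL bw tpermR bu.
  have [->|xw] := eqVneq x w; first by rewrite tpermR bu tpermL bw.
  by have /andP[bxu bxw] := bne x xu xw; rewrite bE // bE // (involP _ bI).
have b'K : perm_on K (tperm u w * b)%g.
  apply: perm_onM bK; apply: perm_on_sub (tperm_on u w).
  by rewrite subUset !sub1set uK.
have f_in : f (s, b) \in rooted_1PI K u set0.
  apply/rooted_1PIP; split=> //.
    apply/setP=> x; rewrite !inE tE; apply/negP=> /andP[xK].
    have [->|xu] := eqVneq x u; first by rewrite tpermL bw (negbTE wu).
    have [->|xw] := eqVneq x w; first by rewrite tpermR bu eq_sym (negbTE wu).
    by rewrite bE // bfix // (negbTE xu) (negbTE xw).
  apply/soundP=> R RK uR R0 sR; apply: leq_trans (bS R RK uR R0 sR) _.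
  apply: subset_leq_card; apply/subsetP=> x; rewrite !inE tE => /andP[xR nb].
  rewrite xR bE //; first by apply: contraNneq uR => <-.
  by apply: contraNneq nb => e; rewrite e bw -e.
apply/setIdP; split; last by rewrite /= tE tpermL bw.
apply/setIdP; split=> //; apply: least_cut_minimal => // [|S' S'K /and4P[uS' _ sS' /= /orP[/eqP//|]]].
  by rewrite /cut uK subxx eqxx /= perm_on_stable.
rewrite tE tpermL bw => /andP[wS' oS'].
suff : 2 < #|out (tperm u w * b)%g S'| by rewrite ltnNge oS'.
(* No smaller cut exists: besides the two or more edges of [b] that leave [S'], the joined edge at
   [u] leaves it too. *)
have sub : u |: out b S' \subset out (tperm u w * b)%g S'.
  apply/subsetP=> x; rewrite !inE tE => /orP[/eqP->|/andP[xS' nb]].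
    by rewrite uS' tpermL bw.
  rewrite xS' bE //; apply: contraNneq nb => e; first by rewrite e bu.
  by move: wS'; rewrite -e xS'.
apply: leq_trans (subset_leq_card sub).
rewrite cardsU1 !inE bu uS' /= ltnS -(@out_setD _ b K) //; last exact: perm_on_stable.
apply: bS; rewrite ?subsetDl ?inE ?uS' //.
  by apply/set0Pn; exists w; rewrite inE wS'.
by apply: stableD => //; exact: perm_on_stable.
Qed.

End LeastCut.

(** * Least cuts that are proper *)

Section ProperCut.
Variable X : finType.
Implicit Types (s b : {perm X}) (K R S T F : {set X}) (u v w r x y : X).
Implicit Types (g : {perm X} * {perm X}).

(** A cut other than [K] is left by at most two edges by definition and by at least two because
    there is no bridge; one of them starts at [u]. *)
Lemma cut_out K u s b S : (s, b) \in rooted_1PI K u set0 -> u \in K ->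
  least_cut K u (s, b) S -> S != K ->
  [/\ S \subset K, u \in S, stable s S, b u \in K :\: S &
    exists2 u', u' \in S :\ u & out b S = [set u; u']].
Proof.
move=> gK uK /least_cutP[/and4P[uS SK sS /= c] _] SnK.
have [sK bK bI bF bS] := rooted_1PIP _ _ _ _ _ gK.
move: c; rewrite (negbTE SnK) /= => /andP[buS oS].
have o2 : #|out b S| = 2.
  apply/eqP; rewrite eqn_leq oS; apply: (sound_proper sK bK bI bS) => //.
  by apply/set0Pn; exists u.
have uo : u \in out b S by rewrite inE uS.
split=> //; first by rewrite inE buS (perm_closed _ bK).
have /cards1P[u' ou'] : #|out b S :\ u| == 1 by move: o2; rewrite (cardsD1 u) uo add1n => -[->].
have : u' \in out b S :\ u by rewrite ou' set11.
rewrite !inE => /and3P[u'u u'S bu'].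
exists u'; first by rewrite !inE u'u.
by rewrite -(setD1K uo) ou'.
Qed.

(** With [S], [u'] and [w] prescribed, cutting ([f]) and gluing ([h]) are inverse to each other. The
    outer end [w'] of the edge at [u'] need not be prescribed: it is the boson neighbour of [w] in
    the second piece. *)
Lemma card_least_piece K S u u' w : u \in S -> S \subset K -> S != K ->
    u' \in S :\ u -> w \in K :\: S ->
  #|[set g in [set g in rooted_1PI K u set0 | least_cut K u g S] |
       (g.2 u == w) && (u' \in out g.2 S)]|
    = #|rooted_1PI S u [set u; u']| * #|rooted_1PI (K :\: S) w set0|.
Proof.
move=> uS SK SnK u'Su wT; pose T := K :\: S.
have uK := subsetP SK _ uS.
have [u'u u'S] : u' != u /\ u' \in S by move: u'Su; rewrite !inE => /andP.
have nS x : x \in T -> (x \in S) = false by rewrite !inE => /andP[/negbTE].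
rewrite -cardsX.
pose f g := ((restr S g.1, perm_fun (cut1_fun S g.2)),
             (restr T g.1, perm_fun (cut2_fun K S u' w g.2))).
pose h (p : ({perm X} * {perm X}) * ({perm X} * {perm X})) :=
  ((p.1.1 * p.2.1)%g, perm_fun (glue_fun S u u' w p.1.2 p.2.2)).
have fP g : g \in [set g in [set g in rooted_1PI K u set0 | least_cut K u g S] |
       (g.2 u == w) && (u' \in out g.2 S)] ->
    f g \in setX (rooted_1PI S u [set u; u']) (rooted_1PI T w set0) /\ h (f g) = g.
  case: g => s b /setIdP[/setIdP[gK lS] /= /andP[/eqP bu u'o]].
  have [sK bK bI bF bS] := rooted_1PIP _ _ _ _ _ gK.
  have [_ _ sS _ [u1 _ o1]] := cut_out gK uK lS SnK.
  have oE : out b S = [set u; u'].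
    by move: u'o; rewrite o1 !inE (negbTE u'u) /= => /eqP <-.
  have sT : stable s T by apply: stableD => //; exact: perm_on_stable.
  have c1I := cut1_involutive S bI.
  have c2I := cut2_involutive uS u'S u'u bK bI bu oE.
  have w'T : b u' \in T := bu'T SK u'S bK oE.
  have b1E := perm_funE (inv_inj c1I).
  have b2E := perm_funE (inv_inj c2I).
  have bw : b w = u by rewrite -bu (involP _ bI).
  have w'w : b u' != w by rewrite -bu (inj_eq perm_inj).
  have bxS x : x \in S -> x != u -> x != u' -> b x \in S.
    move=> xS xu xu'; apply/negPn/negP=> bx.
    have : x \in out b S by rewrite inE xS bx.
    by rewrite oE !inE (negbTE xu) (negbTE xu').
  have b1S : perm_on S (perm_fun (cut1_fun S b)).
    by apply/perm_onP=> x xS; rewrite b1E /cut1_fun (negbTE xS).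
  have b2T : perm_on T (perm_fun (cut2_fun K S u' w b)).
    apply/perm_onP=> x xT; rewrite b2E /cut2_fun.
    case: eqP => [e|_]; first by rewrite e wT in xT.
    case: eqP => [e|_]; first by rewrite e w'T in xT.
    by rewrite (negbTE xT).
  have b1I : invol (perm_fun (cut1_fun S b)) by apply/involP=> x; rewrite !b1E c1I.
  have b2I : invol (perm_fun (cut2_fun K S u' w b)).
    by apply/involP=> x; rewrite !b2E c2I.
  have b1u : perm_fun (cut1_fun S b) u = u.
    by rewrite b1E /cut1_fun bu (nS _ wT) andbF.
  have b1u' : perm_fun (cut1_fun S b) u' = u'.
    by rewrite b1E /cut1_fun (nS _ w'T) andbF.
  have b2w : perm_fun (cut2_fun K S u' w b) w = b u'.
    by rewrite b2E /cut2_fun eqxx.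
  have bb1 x : x \in S -> x != u -> x != u' -> b x = perm_fun (cut1_fun S b) x.
    by move=> xS xu xu'; rewrite b1E /cut1_fun xS bxS.
  have bb2 x : x \in T -> x != w -> x != b u' -> b x = perm_fun (cut2_fun K S u' w b) x.
    by move=> xT xw xw'; rewrite b2E /cut2_fun (negbTE xw) (negbTE xw') xT.
  have s1S := restr_on sS; have s2T := restr_on sT.
  have ss1 : {in S, restr S s =1 s} by move=> x xS; rewrite restrE // xS.
  have ss2 : {in T, restr T s =1 s} by move=> x xS; rewrite restrE // xS.
  (* A smaller set that contains [u] and is left by at most two edges would be a cut strictly inside
     the least one. *)
  have hmin R : R \subset S -> u \in R -> stable s R -> R != S -> 2 < #|out b R|.
    move=> RS uR sR; apply: contraR; rewrite -leqNgt => oR.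
    rewrite eqEsubset RS; have [_ -> //] := least_cutP _ _ _ _ lS.
    rewrite /cut uR (subset_trans RS SK) sR /= oR andbT; apply/orP; right.
    by rewrite bu; apply/negP=> /(subsetP RS); rewrite nS.
  split.
    rewrite inE; apply/andP; split; apply/rooted_1PIP; split=> //.
    - apply/setP=> x; rewrite !inE; have [xS|xS] := boolP (x \in S); last first.
        apply/esym/negP=> /orP[] /eqP e; by rewrite e ?uS ?u'S in xS.
      have [->|xu] := eqVneq x u; first by rewrite b1u eqxx.
      have [->|xu'] := eqVneq x u'; first by rewrite b1u' eqxx orbT.
      by rewrite -bb1 //= (negbTE (vacuum_fixfree gK (subsetP SK _ xS))).
    - exact: (compat_sound1 SK uS u'S s1S ss1 b1S b1I bb1 bS hmin).
    - apply/setP=> x; rewrite !inE; apply/negP=> /andP[]; rewrite -in_setD => xT.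
      have [->|xw] := eqVneq x w; first by rewrite b2w (negbTE w'w).
      have [->|xw'] := eqVneq x (b u').
        by rewrite -b2w (involP _ b2I) b2w eq_sym (negbTE w'w).
      rewrite -bb2 //; apply/negP; apply: (vacuum_fixfree gK).
      by move: xT; rewrite inE => /andP[].
    - exact: (compat_sound2 (erefl T) uS ss2 b2I b2w bb2 bS).
  rewrite /h /f /=; congr pair; apply/permP=> x.
    rewrite permM !restrE //; have [xS|xS] := boolP (x \in S).
      by rewrite inE (stableE _ sS) xS.
    rewrite inE xS /=; case: ifP => // xK; rewrite (out_perm sK) ?xK //.
  rewrite perm_funE; last first.
    apply: inv_inj; apply: (glue_involutive uS u'S u'u wT b1S b2T b1I b2I b1u b1u').
    by rewrite b2w.
  rewrite /glue_fun; have [->//|xu] := eqVneq x u.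
  have [->//|xw] := eqVneq x w.
  have [->//|xu'] := eqVneq x u'.
  rewrite b2w; have [->|xw'] := eqVneq x (b u'); first by rewrite (involP _ bI).
  case: ifP => xS; first by rewrite -bb1.
  have [xT|xT] := boolP (x \in T); first by rewrite -bb2.
  rewrite (out_perm b2T xT) (out_perm bK) //; apply: contra xT => xK.
  by rewrite inE xS.
have hP p : p \in setX (rooted_1PI S u [set u; u']) (rooted_1PI T w set0) ->
    h p \in [set g in [set g in rooted_1PI K u set0 | least_cut K u g S] |
       (g.2 u == w) && (u' \in out g.2 S)] /\ f (h p) = p.
  case: p => [[s1 b1] [s2 b2]]; rewrite inE => /andP[g1 g2].
  have [s1S b1S b1I b1F b1sound] := rooted_1PIP _ _ _ _ _ g1.
  have [s2T b2T b2I b2F b2sound] := rooted_1PIP _ _ _ _ _ g2.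
  have b1fix x : x \in S -> (b1 x == x) = (x == u) || (x == u').
    by move=> xS; move/setP/(_ x): b1F; rewrite !inE xS.
  have b1u : b1 u = u by apply/eqP; rewrite b1fix // eqxx.
  have b1u' : b1 u' = u' by apply/eqP; rewrite b1fix // eqxx orbT.
  have b2w := vacuum_fixfree g2 wT.
  have gI := glue_involutive uS u'S u'u wT b1S b2T b1I b2I b1u b1u' b2w.
  have bE := perm_funE (inv_inj gI).
  set b := perm_fun (glue_fun S u u' w b1 b2) in bE *.
  have w'T : b2 w \in T by rewrite (perm_closed _ b2T).
  have neS y z : y \in S -> z \in T -> (y == z) = false.
    by move=> yS zT; apply: contraTF yS => /eqP ->; rewrite nS.
  have bu : b u = w by rewrite bE /glue_fun eqxx.
  have bu' : b u' = b2 w by rewrite bE /glue_fun (negbTE u'u) (neS _ _ u'S wT) eqxx.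
  have bI : invol b by apply/involP=> x; rewrite !bE gI.
  have bb1 x : x \in S -> x != u -> x != u' -> b x = b1 x.
    move=> xS xu xu'; rewrite bE /glue_fun (negbTE xu) (negbTE xu').
    by rewrite (neS _ _ xS wT) (neS _ _ xS w'T) xS.
  have bb2 x : x \in T -> x != w -> x != b2 w -> b x = b2 x.
    move=> xT xw xw'; rewrite bE /glue_fun (negbTE xw) (negbTE xw') nS //.
    by rewrite (eq_sym x u) (eq_sym x u') !neS.
  have TK : T \subset K := subsetDl _ _.
  have bK : perm_on K b.
    apply/perm_onP=> x xK; have xS : x \in S = false.
      by apply: contraNF xK; exact: (subsetP SK).
    have xT : x \notin T by apply: contra xK; exact: (subsetP TK).
    rewrite bE /glue_fun xS (out_perm b2T xT).
    do 4!(case: eqP => [e|_]; first by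
      rewrite e ?(subsetP SK _ uS) ?(subsetP TK _ wT) ?(subsetP SK _ u'S)
        ?(subsetP TK _ w'T) in xK).
    by [].
  have sK : perm_on K (s1 * s2)%g.
    by apply: perm_onM; [apply: perm_on_sub s1S | apply: perm_on_sub s2T].
  have ss1 : {in S, s1 =1 (s1 * s2)%g}.
    move=> x xS; rewrite permM (out_perm s2T) // inE negb_and negbK.
    by rewrite (perm_closed _ s1S) xS.
  have ss2 : {in T, s2 =1 (s1 * s2)%g}.
    by move=> x xT; rewrite permM (out_perm s1S) // nS.
  have sS : stable (s1 * s2)%g S.
    by apply/stableP=> x xS; rewrite -ss1 // (perm_closed _ s1S).
  have sT : stable (s1 * s2)%g T by apply: stableD => //; exact: perm_on_stable.
  have bw : b w = u by rewrite -bu (involP _ bI).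
  have bw' : b (b2 w) = u' by rewrite -bu' (involP _ bI).
  have outE : out b S = [set u; u'].
    apply/setP=> x; rewrite !inE.
    have [->|xu] := eqVneq x u; first by rewrite bu uS nS.
    have [->|xu'] := eqVneq x u'; first by rewrite bu' u'S nS.
    by apply/negP=> /andP[xS]; rewrite bb1 // (perm_closed _ b1S) xS.
  have gK : ((s1 * s2)%g, b) \in rooted_1PI K u set0.
    apply/rooted_1PIP; split=> //.
      apply/setP=> x; rewrite !inE; apply/negP=> /andP[xK].
      have [->|xu] := eqVneq x u; first by rewrite bu eq_sym neS.
      have [->|xu'] := eqVneq x u'; first by rewrite bu' eq_sym neS.
      have [->|xw] := eqVneq x w; first by rewrite bw neS.
      have [->|xw'] := eqVneq x (b2 w); first by rewrite bw' neS.
      have [xS|xS] := boolP (x \in S).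
        by rewrite bb1 // b1fix // (negbTE xu) (negbTE xu').
      have xT : x \in T by rewrite inE xS.
      by rewrite bb2 // (negbTE (vacuum_fixfree g2 xT)).
    exact: (compat_sound (erefl T) uS u'S wT w'T b2w s1S s2T ss1 ss2 b1S b2T bI b2I bu bu' b1u' bb1 bb2 b1sound b2sound).
  split.
    apply/setIdP; split; last by rewrite bu eqxx outE !inE eqxx orbT.
    apply/setIdP; split=> //; apply: least_cut_minimal => //.
      by rewrite /cut uS SK sS /= outE cards2 bu nS // ltnS leq_b1 orbT.
    move=> R RS /and4P[uR _ sR /= c]; apply/eqP/negPn/negP=> RnS.
    have := compat_minimal (erefl T) wT s1S ss1 b1S b1I bu b1u b1u' bb1 b1sound RS uR sR RnS.
    rewrite ltnNge; move: c => /orP[/eqP RK|/andP[_ -> //]].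
    by case/eqP: SnK; apply/eqP; rewrite eqEsubset SK -RK.
  have c1I := cut1_involutive S bI.
  have c2I := cut2_involutive uS u'S u'u bK bI bu outE.
  rewrite /h /f /= -/b; congr pair; congr pair; apply/permP=> x.
  - rewrite restrE //; case: ifP => xS; first by rewrite -ss1.
    by rewrite (out_perm s1S) // xS.
  - rewrite (perm_funE (inv_inj c1I)) /cut1_fun.
    have [xS|xS] := boolP (x \in S) => /=; last by rewrite (out_perm b1S).
    have [->|xu] := eqVneq x u; first by rewrite bu b1u nS.
    have [->|xu'] := eqVneq x u'; first by rewrite bu' b1u' nS.
    by rewrite bb1 // (perm_closed _ b1S) xS.
  - rewrite restrE //; case: ifP => xT; first by rewrite -ss2.
    by rewrite (out_perm s2T) // xT.
  rewrite (perm_funE (inv_inj c2I)) /cut2_fun bu'.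
  have [->//|xw] := eqVneq x w.
  have [->|xw'] := eqVneq x (b2 w); first by rewrite (involP _ b2I).
  by case: ifP => xT; [rewrite bb2 | rewrite (out_perm b2T) // xT].
apply: (@card_in_bij _ _ _ _ f h) => x xP.
- by have [] := fP x xP.
- by have [] := hP x xP.
- by have [] := fP x xP.
- by have [] := hP x xP.
Qed.

Lemma card_least_proper K S u : u \in S -> S \subset K -> S != K ->
  #|[set g in rooted_1PI K u set0 | least_cut K u g S]|
    = \sum_(u' in S :\ u) \sum_(w in K :\: S)
        #|rooted_1PI S u [set u; u']| * #|rooted_1PI (K :\: S) w set0|.
Proof.
move=> uS SK SnK.
have uK := subsetP SK _ uS.
rewrite (@card_fibers _ _ _ (setX (S :\ u) (K :\: S))
   (fun (g : {perm X} * {perm X}) p => (g.2 u == p.2) && (p.1 \in out g.2 S))).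
  rewrite pair_big /=; apply: eq_big => [[u' w]|[u' w]]; first by rewrite inE.
  by rewrite inE /= => /andP[u'S wT]; exact: card_least_piece.
case=> s b /setIdP[gK lS].
have [_ _ _ bu [u' u'S oE]] := cut_out gK uK lS SnK.
exists (u', b u) => [|[y z]]; first by rewrite inE u'S.
rewrite inE /= => /andP[/setD1P[yu yS] _].
by rewrite oE !inE (negbTE yu) /= xpair_eqE eq_sym andbC.
Qed.

End ProperCut.

(** * The recursion for tadpoles *)

Lemma sum_sets_containing m (x0 : 'I_m.+1) (F : nat -> nat) :
  \sum_(S : {set 'I_m.+1} | x0 \in S) F #|S :\ x0| = \sum_(k < m.+1) 'C(m, k) * F k.
Proof.
rewrite (reindex_onto (fun B : {set 'I_m.+1} => x0 |: B) (fun S => S :\ x0)) /=; last first.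
  by move=> S x0S; rewrite setD1K.
have cP (B : {set 'I_m.+1}) : B \subset [set~ x0] -> #|B| < m.+1.
  by move=> /subset_leq_card; rewrite cardsC1 card_ord ltnS.
rewrite (eq_big (fun B : {set 'I_m.+1} => B \subset [set~ x0]) (fun B => F #|B|)); first last.
- by move=> B /andP[_ /eqP ->].
- move=> B; rewrite setU11 /= subsetC sub1set inE; apply/eqP/idP => [<-|x0B]; first by rewrite setD11.
  by rewrite setU1K.
rewrite (partition_big (fun B : {set 'I_m.+1} => inord #|B| : 'I_m.+1) predT) //=.
apply: eq_bigr => k _; rewrite (eq_bigr (fun _ => F k)); last first.
  by move=> B /andP[BC /eqP <-]; rewrite inordK // cP.
rewrite sum_nat_const; congr (_ * _).
have cm : #|[set~ x0]| = m by rewrite cardsC1 card_ord.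
have -> : 'C(m, k) = 'C(#|[set~ x0]|, k) by rewrite cm.
rewrite -cards_draws; apply: eq_card => B; rewrite !inE unfold_in.
by have [BC|//] := boolP (B \subset _); rewrite /= -val_eqE /= inordK // cP.
Qed.

(** [k] is the number of vertices of the least cut besides the root. The first factor [k] chooses
    [u'], and the inner product counts the piece with its two legs. The choice of [w] and the vacuum
    graph on the rest combine to a tadpole count by [rooted_tadpole_countS]. A least cut equal to
    the whole graph is the term [k = m], where [rooted_tadpole_count 0 = 1]. *)
Lemma rooted_vacuum_count_rec m :
  rooted_vacuum_count m = \sum_(k < m.+1)
    'C(m, k) * (k * (k * rooted_tadpole_count k.-1) * rooted_tadpole_count (m - k)).
Proof.
rewrite -(sum_sets_containing ord0
  (fun k => k * (k * rooted_tadpole_count k.-1) * rooted_tadpole_count (m - k))).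
rewrite /rooted_vacuum_count (card_vacua_least_cut (in_setT _)).
apply: eq_big => [S|S /andP[uS _]]; first by rewrite subsetT andbT.
set k := #|S :\ ord0|.
have Sk : #|S| = k.+1 by rewrite (cardsD1 ord0) uS.
have c2 w : w \in S :\ ord0 -> #|rooted_1PI S ord0 [set ord0; w]| = k * rooted_tadpole_count k.-1.
  move=> wS; have k0 : 0 < k by rewrite card_gt0; apply/set0Pn; exists w.
  move: wS; rewrite !inE => /andP[w0 wS].
  by rewrite (@card_two_legs _ _ _ _ k.-1) ?prednK.
have [ST|SnT] := eqVneq S setT.
  have km : k = m by apply: succn_inj; rewrite -Sk ST cardsT card_ord.
  rewrite ST card_least_full ?inE // -ST (eq_bigr (fun _ => k * rooted_tadpole_count k.-1)) //.
  by rewrite sum_nat_const -/k -km subnn rooted_tadpole_count0 muln1.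
rewrite card_least_proper ?subsetT //.
have cT : #|setT :\: S| = m - k by rewrite setTD cardsCs setCK card_ord Sk subSS.
have lm : 0 < m - k.
  rewrite -cT card_gt0 setD_eq0; apply: contra SnT => TS.
  by rewrite eqEsubset subsetT.
rewrite (eq_bigr (fun _ => (k * rooted_tadpole_count k.-1) * rooted_tadpole_count (m - k))).
  by rewrite sum_nat_const -/k mulnA.
move=> w wS; rewrite (eq_bigr (fun _ => (k * rooted_tadpole_count k.-1) * rooted_vacuum_count (m - k).-1)).
  by rewrite sum_nat_const cT mulnCA -{1 3}(prednK lm) -rooted_tadpole_countS.
by move=> z zT; rewrite c2 // (@card_rooted_vacua _ _ _ (m - k).-1) // cT prednK.
Qed.

(** * Tadpoles as rooted 1PI graphs *)

Lemma perm_onT (T : finType) (s : {perm T}) : perm_on setT s.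
Proof. by apply/subsetP=> x; rewrite inE. Qed.

(** Turns paths into closed sets, the language in which [sound] is stated. *)
Lemma connect_stable (T : finType) (e : rel T) : symmetric e ->
  (forall x y, connect e x y) <->
  (forall R : {set T}, R != set0 -> (forall x y, e x y -> x \in R -> y \in R) ->
     R = setT).
Proof.
move=> e_sym; split=> [ce R /set0Pn[x xR] Re|h x y].
  apply/setP=> y; rewrite inE; have cl : closed e (mem R).
    by apply: (intro_closed (sym_connect_sym e_sym)) => a b ab; exact: Re.
  by rewrite -(closed_connect cl (ce x y)).
have xyR : [set z | connect e x z] = setT.
  apply: h; first by apply/set0Pn; exists x; rewrite inE connect0.
  by move=> a b ab; rewrite !inE => /connect_trans; apply; exact: connect1.
by have := in_setT y; rewrite -xyR inE.
Qed.

Section BosonEdges.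
Variables (V : nat) (b : {perm 'I_V}).
Hypothesis bI : invol b.

Lemma boson_edgesE (C : {set 'I_V}) (x : 'I_V) :
  C \in boson_edges b -> x \in C -> C = [set x; b x] /\ b x != x.
Proof.
case/imsetP=> v; rewrite inE => bv ->; rewrite !inE => /orP[]/eqP-> //.
by rewrite (involP _ bI) setUC eq_sym.
Qed.

Lemma boson_edges_partition :
  partition (boson_edges b) [set v | b v != v] /\
  forall C, C \in boson_edges b -> #|C| = 2.
Proof.
split; last first.
  move=> C /imsetP[v]; rewrite inE => bv ->.
  by rewrite cards2 eq_sym bv.
apply/and3P; split.
- apply/eqP/setP=> x; rewrite inE; apply/bigcupP/idP=> [[C CB xC]|bx].
    by have [] := boson_edgesE CB xC.
  by exists [set x; b x]; rewrite ?set21 //; apply/imsetP; exists x; rewrite ?inE.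
- apply/trivIsetP=> C D CB DB; apply: contraNT => /pred0Pn[x /andP[/= xC xD]].
  have [-> _] := boson_edgesE CB xC; by have [<- _] := boson_edgesE DB xD.
apply/imsetP=> [[v _ e]]; have := set21 v (b v); by rewrite -e inE.
Qed.

Lemma card_boson_edges : #|boson_edges b|.*2 = #|[set v | b v != v]|.
Proof.
have [P C2] := boson_edges_partition.
by rewrite (card_uniform_partition C2 P) muln2.
Qed.

End BosonEdges.

Section Tadpoles.
Variable V : nat.
Implicit Types (s b phi : {perm 'I_V}) (r : 'I_V) (g h : {perm 'I_V} * {perm 'I_V}).

Lemma graph_rel_sym s b dF dB : invol b -> symmetric (graph_rel s b dF dB).
Proof.
move=> /involP bI x y; rewrite /graph_rel orbCA; congr (_ || (_ || _)).
have -> : (b x == y) = (b y == x) by rewrite -[LHS](inj_eq (@perm_inj _ b)) bI eq_sym.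
by rewrite [y == x]eq_sym (setUC [set y]).
Qed.

Lemma rel_connectedP (e : rel 'I_V) : symmetric e ->
  reflect (forall R : {set 'I_V}, R != set0 ->
     (forall x y, e x y -> x \in R -> y \in R) -> R = setT) (rel_connected e).
Proof.
move=> /connect_stable H; apply: (iffP idP) => [h|h].
  by apply: (proj1 H) => x y; have /forallP/(_ x)/forallP/(_ y) := h.
by apply/forallP=> x; apply/forallP=> y; exact: (proj2 H h).
Qed.

(* Dropping a fermion edge never disconnects, since it lies on a cycle. *)
Lemma drop_fermion_stable s (R : {set 'I_V}) e :
  (forall x, x != e -> (s x \in R) = (x \in R)) -> stable s R.
Proof.
move=> h; have sub : R :\ e \subset s @^-1: R.
  by apply/subsetP=> x; rewrite !inE => /andP[/h ->].
have card_pre : #|s @^-1: R| = #|R| by rewrite on_card_preimset //; exists s^-1%g => x _; rewrite ?permK ?permKV.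
apply/stableP=> x xR; have [xe|xe] := eqVneq x e; last by rewrite h.
rewrite xe in xR *; apply/negPn/negP => seR.
have sub' : s @^-1: R \subset R :\ e.
  apply/subsetP=> y; rewrite !inE; have [->|ye] := eqVneq y e; first by rewrite (negbTE seR).
  by rewrite h.
have := subset_leq_card sub'; rewrite card_pre (cardsD1 e R) xR; lia.
Qed.

(** Connectedness says that no proper stable set is left by zero boson edges, and the absence of
    boson bridges excludes exactly one. Sets containing [r] are handled through their
    complements. *)
Lemma is_1PI_sound s b r : invol b -> [set v | b v == v] = [set r] ->
  is_1PI s b = sound s b setT r.
Proof.
move=> bI bF.
have bfix x : (b x == x) = (x == r) by move/setP/(_ x): bF; rewrite !inE.
have symg dF dB := @graph_rel_sym s b dF dB bI.
apply/and3P/soundP=> [[/(rel_connectedP (symg _ _)) h0 _ /forallP h2] R _ rR R0 sR|hS].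
  rewrite ltnNge leq_eqVlt ltnS leqn0 cards_eq0.
  have RT : R <> setT by move=> e; move: rR; rewrite e inE.
  apply/negP=> /orP[/cards1P[e oe]|/eqP oe]; apply: RT.
    have : e \in out b R by rewrite oe set11.
    rewrite inE => /andP[eR beR].
    have be : b e != e by apply: contraNneq beR => ->.
    have /(rel_connectedP (symg _ _)) := implyP (h2 e) be.
    apply=> // x y /or3P[/andP[/eqP<- _]|/andP[/eqP<- _]|/and3P[/eqP<- xbx nd] xR].
    - by rewrite stableE.
    - by rewrite stableE.
    apply/negPn/negP=> bxR; have : x \in out b R by rewrite inE xR.
    by rewrite oe inE => /eqP ex; move: nd; rewrite ex /= eqxx.
  apply: h0 => // x y /or3P[/andP[/eqP<- _]|/andP[/eqP<- _]|/and3P[/eqP<- _ _] xR].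
  - by rewrite stableE.
  - by rewrite stableE.
  by apply/negPn/negP=> bxR; move/setP/(_ x): oe; rewrite !inE xR bxR.
(* If all outgoing edges of [R] coincide with the single edge from [e] to [b e], at most one of its
   two ends counts in [out b R], which is too few for a proper [R]. *)
have key (R : {set 'I_V}) (e : 'I_V) : R != set0 -> stable s R ->
    (forall x, x \in R -> b x \notin R -> x \in [set e; b e]) -> R = setT.
  move=> R0 sR he; apply/eqP/negPn/negP=> RT.
  have : 1 < #|out b R|.
    have [rR|rR] := boolP (r \in R); last by apply: hS; rewrite ?subsetT.
    rewrite -(out_setD bI (perm_on_stable (perm_onT b)) (subsetT R)).
    apply: hS; rewrite ?subsetT ?inE ?rR //.
      by rewrite setD_eq0; apply: contra RT => TR; rewrite eqEsubset subsetT.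
    by apply: stableD => //; apply: stable_eq => x; rewrite !inE.
  have [a oa] : exists a, out b R \subset [set a].
    have [eR|eR] := boolP (e \in R).
      exists e; apply/subsetP=> x; rewrite !inE => /andP[xR bxR].
      have := he x xR bxR; rewrite !inE => /orP[//|/eqP xe].
      by move: bxR; rewrite xe (involP _ bI) eR.
    exists (b e); apply/subsetP=> x; rewrite !inE => /andP[xR bxR].
    have := he x xR bxR; rewrite !inE => /orP[/eqP xe|//].
    by rewrite xe (negbTE eR) in xR.
  by rewrite ltnNge -(cards1 a) subset_leq_card.
have closeds (R : {set 'I_V}) dF dB :
    (forall x, dF x = false) ->
    (forall x y, graph_rel s b dF dB x y -> x \in R -> y \in R) -> stable s R.
  by move=> dF0 hR; apply/stableP=> x; apply: hR; rewrite /graph_rel eqxx dF0.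
split.
- apply/(rel_connectedP (symg _ _)) => R R0 hR.
  (* No boson edge leaves [R] here, so the edge passed to [key] is arbitrary. *)
  apply: (key R r) => //; first exact: closeds hR.
  move=> x xR; case/negP; have [bx|bx] := eqVneq (b x) x.
    by rewrite bx.
  apply: hR xR; rewrite /graph_rel eqxx [x == _]eq_sym bx /=.
  by rewrite !orbT.
- apply/forallP=> e; apply/(rel_connectedP (symg _ _)) => R R0 hR.
  have sR : stable s R.
    apply: (@drop_fermion_stable _ _ e) => x xe; apply/idP/idP; apply: hR;
    by rewrite /graph_rel eqxx /= xe ?orbT.
  apply: (key R r) => //.
  move=> x xR; case/negP; have [bx|bx] := eqVneq (b x) x.
    by rewrite bx.
  apply: hR xR; rewrite /graph_rel eqxx [x == _]eq_sym bx /=.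
  by rewrite !orbT.
apply/forallP=> e; apply/implyP=> be; apply/(rel_connectedP (symg _ _)) => R R0 hR.
apply: (key R e) => //; first exact: closeds hR.
move=> x xR bxR; apply/negPn/negP=> xe; move/negP: bxR; apply.
have [bx|bx] := eqVneq (b x) x; first by rewrite bx.
apply: hR xR; rewrite /graph_rel eqxx [x == _]eq_sym bx /=.
apply/orP; right; apply/orP; right; apply: contra xe => /eqP <-.
exact: set21.
Qed.

Lemma is_tadpoleP s b :
  reflect (exists r, (s, b) \in rooted_1PI setT r [set r]) (is_tadpole s b).
Proof.
apply: (iffP and3P) => [[bI /cards1P[r bF]]|[r /rooted_1PIP[_ _ bI bF bS]]].
  rewrite (is_1PI_sound _ bI bF) => bS; exists r; apply/rooted_1PIP.
  split; rewrite ?perm_onT //.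
  by rewrite -bF; apply/setP=> x; rewrite !inE.
have bF' : [set v | b v == v] = [set r] by rewrite -bF; apply/setP=> x; rewrite !inE.
by rewrite bF' cards1 (is_1PI_sound _ bI bF').
Qed.

Lemma fix_root s b r : (s, b) \in rooted_1PI setT r [set r] -> forall x, (b x == x) = (x == r).
Proof. by move=> /rooted_1PIP[_ _ _ /setP bF _] x; have := bF x; rewrite !inE. Qed.

End Tadpoles.

(** * Relabellings and isomorphism classes *)

Section Orbits.
Variable V : nat.
Implicit Types (s b phi : {perm 'I_V}) (r : 'I_V) (g h : {perm 'I_V} * {perm 'I_V}).

Definition labelled_tadpoles : {set {perm 'I_V} * {perm 'I_V}} := [set g | is_tadpole g.1 g.2].

Definition conj_graph g phi := ((g.1 ^ phi)%g, (g.2 ^ phi)%g).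

(** Relabelling by [phi] is transport along [phi], so [plift_rooted_1PI] shows that it preserves
    tadpoles. *)
Lemma plift_conj phi s : plift phi s = (s ^ phi)%g.
Proof.
apply/permP=> x; rewrite -[x](permKV phi) pliftE ?permJ //; exact: perm_inj.
Qed.

Lemma yisoP g h : reflect (exists phi, h = conj_graph g phi) (yiso g h).
Proof.
apply: (iffP existsP) => [[phi /forallP H]|[phi ->]]; exists phi.
  case: h H => h1 h2 H; rewrite /conj_graph; congr pair; apply/permP=> x;
  by rewrite -[x](permKV phi) permJ; have /andP[/eqP e1 /eqP e2] := H (phi^-1%g x).
by apply/forallP=> v; rewrite /= !permJ !eqxx.
Qed.

Lemma conj_graphM g phi psi : conj_graph (conj_graph g phi) psi = conj_graph g (phi * psi)%g.
Proof. by rewrite /conj_graph !conjgM. Qed.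

Lemma conj_graph1 g : conj_graph g 1%g = g.
Proof. by case: g => s b; rewrite /conj_graph !conjg1. Qed.

Lemma yiso_equiv g1 g2 g3 : yiso g3 g3 * (yiso g1 g2 -> yiso g1 g3 = yiso g2 g3).
Proof.
split; first by apply/yisoP; exists 1%g; rewrite conj_graph1.
case/yisoP=> phi ->; apply/yisoP/yisoP=> -[psi ->].
  by exists (phi^-1 * psi)%g; rewrite conj_graphM mulgA mulgV mul1g.
by exists (phi * psi)%g; rewrite conj_graphM.
Qed.

Lemma conj_labelled_tadpoles g phi : (conj_graph g phi \in labelled_tadpoles) = (g \in labelled_tadpoles).
Proof.
have imp k psi : k \in labelled_tadpoles -> conj_graph k psi \in labelled_tadpoles.
  case: k => s b; rewrite !inE /= => /is_tadpoleP[r gr].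
  apply/is_tadpoleP; exists (psi r).
  rewrite -!plift_conj -imset_set1.
  have -> : [set: 'I_V] = psi @: setT.
    by apply/esym/eqP; rewrite eqEcard subsetT card_imset ?leqnn //; exact: perm_inj.
  by rewrite plift_rooted_1PI //; exact: perm_inj.
apply/idP/idP; last exact: imp.
by move=> /(imp _ phi^-1%g); rewrite conj_graphM mulgV conj_graph1.
Qed.

(* The vertices fixed by an automorphism form a union of fermion cycles that
   contains the external leg and is left by no boson edge. *)
Lemma conj_graph_inj g : g \in labelled_tadpoles -> injective (conj_graph g).
Proof.
case: g => s b gt phi psi; rewrite /conj_graph /= => -[es eb].
move: gt; rewrite inE => /is_tadpoleP[r gr].
have [_ _ bI bF /soundP bS] := rooted_1PIP _ _ _ _ _ gr.
pose th := (phi * psi^-1)%g.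
have ths x : th (s x) = s (th x).
  apply: (@perm_inj _ psi); rewrite -[RHS]permJ -es /th !permM !permKV.
  by rewrite permK.
have thb x : th (b x) = b (th x).
  apply: (@perm_inj _ psi); rewrite -[RHS]permJ -eb /th !permM !permKV.
  by rewrite permK.
have thr : th r = r.
  by apply/eqP; rewrite -(fix_root gr) -thb; have /eqP -> : b r == r by rewrite (fix_root gr).
pose R := [set x | th x != x].
have R0 : R = set0.
  apply/eqP/negPn/negP=> R0; have: 1 < #|out b R|.
    apply: bS; rewrite ?subsetT ?inE ?thr ?eqxx //.
    by apply: stable_eq => x; rewrite !inE ths (inj_eq perm_inj).
  suff -> : out b R = set0 by rewrite cards0.
  by apply/setP=> x; rewrite !inE thb (inj_eq perm_inj) andbN.
have th1 : th = 1%g.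
  by apply/permP=> x; rewrite perm1; move/setP/(_ x): R0; rewrite !inE => /negbFE/eqP.
by rewrite -[phi]mulg1 -(mulVg psi) mulgA -/th th1 mul1g.
Qed.

(** Each class is an orbit of the group of relabellings, of full size because a tadpole has no
    automorphisms. *)
Lemma card_tadpole_classes :
  #|[set [set h in labelled_tadpoles | yiso g h] | g in labelled_tadpoles]| * V`! = #|labelled_tadpoles|.
Proof.
rewrite -[[set _ | g in labelled_tadpoles]]/(equivalence_partition (@yiso V) labelled_tadpoles).
have P : partition (equivalence_partition (@yiso V) labelled_tadpoles) labelled_tadpoles.
  by apply: equivalence_partitionP => x y z _ _ _; exact: yiso_equiv.
rewrite (@card_uniform_partition _ V`! _ _ _ P) // => A /imsetP[g gt ->].
have -> : [set h in labelled_tadpoles | yiso g h] = conj_graph g @: [set: {perm 'I_V}].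
  apply/setP=> h; rewrite inE; apply/andP/imsetP => [[_ /yisoP[phi ->]]|[phi _ ->]].
    by exists phi.
  by rewrite conj_labelled_tadpoles; split=> //; apply/yisoP; exists phi.
by rewrite card_imset ?cardsT ?card_Sn //; exact: conj_graph_inj.
Qed.

End Orbits.

Lemma card_labelled_tadpoles m : #|labelled_tadpoles m.+1| = m.+1 * rooted_tadpole_count m.
Proof.
rewrite (@card_fibers _ _ _ [set: 'I_m.+1] (fun (g : {perm _} * {perm _}) r => g.2 r == r)).
  rewrite (eq_bigr (fun _ => rooted_tadpole_count m)) => [|r _]; first by rewrite sum_nat_const cardsT card_ord.
  rewrite -(@card_rooted_tadpoles _ setT r m) ?cardsT ?card_ord //; apply: eq_card => -[s b].
  rewrite !in_set; apply/andP/idP => [[/is_tadpoleP[x gx]]|gr].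
    by rewrite /= (fix_root gx) => /eqP ->; move: gx; rewrite inE.
  split; first by apply/is_tadpoleP; exists r; rewrite inE.
  by rewrite /= (@fix_root _ s b r) ?eqxx // inE.
case=> s b; rewrite inE => /is_tadpoleP[r gr]; exists r => // x _.
exact: (fix_root gr).
Qed.

(** The boson edges pair up the [m] vertices other than the root. *)
Lemma rooted_tadpole_count_odd m : odd m -> rooted_tadpole_count m = 0.
Proof.
move=> mo; apply/eqP; rewrite cards_eq0; apply/eqP/setP=> -[s b]; rewrite in_set0.
apply/negP=> gr; have [_ _ bI bF _] := rooted_1PIP _ _ _ _ _ gr.
have := card_boson_edges bI.
have -> : [set v | b v != v] = [set~ ord0].
  by apply/setP=> v; rewrite !inE (fix_root gr).
rewrite cardsC1 card_ord /= => e.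
by move: mo; rewrite -e odd_double.
Qed.

(** The 2n+1 possible positions of the leg cancel one factor of (2n+1)!. The condition on the loop
    number is automatic: the other 2n vertices form n boson edges. *)
Lemma tadpole_count_rooted n : tadpole_count n.+1 * (n.*2)`! = rooted_tadpole_count n.*2.
Proof.
apply/eqP; rewrite -(eqn_pmul2l (ltn0Sn n.*2)) -card_labelled_tadpoles mulnCA -factS.
rewrite -card_tadpole_classes; apply/eqP; congr (_ * _).
rewrite /tadpole_count.
suff -> : tadpoles n.+1 = labelled_tadpoles n.*2.+1 by [].
apply/setP=> -[s b]; rewrite !inE /=; case: is_tadpoleP => //= -[r gr].
have [_ _ bI bF _] := rooted_1PIP _ _ _ _ _ gr.
have e := card_boson_edges bI.
have fE : [set v | b v != v] = [set~ r].
  by apply/setP=> v; rewrite !inE (fix_root gr).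
rewrite /loop_number -addnS addKn; apply/eqP.
move: e; rewrite fE cardsC1 card_ord /=; move=> /double_inj ->; by [].
Qed.

Lemma tadpole_count0 : tadpole_count 0 = 0.
Proof.
apply/eqP; rewrite /tadpole_count cards_eq0 -subset0; apply/subsetP=> A /imsetP[[s b]].
rewrite inE => /andP[/and3P[_ /cards1P[x _] _] _]; by case: x.
Qed.

Lemma tadpole_count1 : tadpole_count 1 = 1.
Proof. by have := tadpole_count_rooted 0; rewrite rooted_tadpole_count0 muln1. Qed.

Lemma tadpole_count_rec n :
  tadpole_count n.+2 =
    \sum_(i < n.+1) (i.*2.+1) * tadpole_count i.+1 * tadpole_count (n - i).+1.
Proof.
apply/eqP; rewrite -(eqn_pmul2r (fact_gt0 n.*2.+2)) -doubleS tadpole_count_rooted.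
rewrite doubleS rooted_tadpole_countS factS mulnCA; apply/eqP; congr (_ * _).
rewrite rooted_vacuum_count_rec big_distrl /=.
pose F k := 'C(n.*2.+1, k) * (k * (k * rooted_tadpole_count k.-1) * rooted_tadpole_count (n.*2.+1 - k)).
rewrite -(big_mkord predT F) /=.
(* Only odd [k] contribute: for even [k] the last factor has an odd index and vanishes. *)
have split2 p : \sum_(0 <= k < p.*2) F k = \sum_(0 <= i < p) (F i.*2 + F i.*2.+1).
  elim: p => [|p IH]; first by rewrite !big_nil.
  by rewrite doubleS !big_nat_recr //= IH addnA.
rewrite -doubleS split2 big_mkord; apply: eq_bigr => i _.
have ile : i <= n by rewrite -ltnS.
have F0 : F i.*2 = 0.
  rewrite /F [rooted_tadpole_count (_ - _)]rooted_tadpole_count_odd ?muln0 // oddB /= ?odd_double //.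
  by rewrite ltnW // ltnS leq_double.
rewrite F0 add0n /F subSS -doubleB /= -!tadpole_count_rooted.
(* The binomial coefficient cancels against the factorials; of the two factors [k = 2i+1] one
   completes [k!] and the other remains. *)
have := @bin_fact n.*2.+1 i.*2.+1; rewrite subSS -doubleB ltnS leq_double ile => /(_ isT) <-.
rewrite factS; ring.
Qed.

(** * Connected chord diagrams *)

Section Chords.
Variable N : nat.
Implicit Types (b : {perm 'I_N}) (K J S R : {set 'I_N}) (u x y z : 'I_N).

(** Intervals are relative to [K], so that a piece of a diagram is judged by the order of its own
    points. *)
Definition convex K J :=
  (J \subset K) &&
  [forall x in J, forall z in J, forall y in K, (x < y < z) ==> (y \in J)].

Lemma convexP K J :
  reflect (J \subset K /\
     forall x y z, x \in J -> z \in J -> y \in K -> x < y -> y < z -> y \in J)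
    (convex K J).
Proof.
apply: (iffP andP) => -[JK h]; split=> //.
  move=> x y z xJ zJ yK xy yz.
  have /forall_inP/(_ x xJ)/forall_inP/(_ z zJ)/forall_inP/(_ y yK) := h.
  by rewrite xy yz.
apply/forall_inP=> x xJ; apply/forall_inP=> z zJ; apply/forall_inP=> y yK.
by apply/implyP=> /andP[]; exact: h.
Qed.

Definition nonsplit b K u :=
  [forall J : {set 'I_N}, [&& convex K J, u \notin J & J != set0] ==> ~~ stable b J].

Lemma nonsplitP b K u :
  reflect (forall J, convex K J -> u \notin J -> stable b J -> J = set0) (nonsplit b K u).
Proof.
apply: (iffP forallP) => h J; last first.
  by apply/implyP=> /and3P[cJ uJ]; apply: contra => /(h J cJ uJ) ->.
move=> cJ uJ sJ; apply/eqP/negPn/negP=> J0.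
by have /implyP := h J; rewrite cJ uJ J0 sJ => /(_ isT).
Qed.

(* When [u] is the least point of [K], these are the connected chord diagrams
   on [K]. *)
Definition conn_diagrams K u : {set {perm 'I_N}} :=
  [set b | [&& perm_on K b, invol b, [set x in K | b x == x] == set0 & nonsplit b K u]].

Lemma conn_diagramsP K u b :
  reflect [/\ perm_on K b, invol b, forall x, x \in K -> b x != x & nonsplit b K u]
    (b \in conn_diagrams K u).
Proof.
rewrite inE; apply: (iffP and4P) => -[bK bI bF bS]; split=> //.
  by move=> x xK; move/eqP/setP/(_ x): bF; rewrite !inE xK => /negbT.
apply/eqP/setP=> x; rewrite !inE; apply/negP=> /andP[xK]; exact/negP/bF.
Qed.

End Chords.

Lemma plift_nonsplit m N (h : 'I_m -> 'I_N) (b : {perm 'I_m}) (K : {set 'I_m}) u :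
  {mono h : x y / x < y} -> injective h ->
  nonsplit (plift h b) (h @: K) (h u) = nonsplit b K u.
Proof.
move=> h_mono h_inj.
have cvx (J : {set 'I_m}) : convex (h @: K) (h @: J) = convex K J.
  apply/convexP/convexP=> -[JK H]; split.
  - by apply/subsetP=> x /(imset_f h)/(subsetP JK); rewrite imset_inE.
  - move=> x y z xJ zJ yK xy yz; rewrite -(imset_inE h_inj).
    by apply: (H (h x) (h y) (h z)); rewrite ?imset_inE ?h_mono.
  - exact: imsetS.
  move=> _ _ _ /imsetP[x xJ ->] /imsetP[z zJ ->] /imsetP[y yK ->].
  by rewrite !h_mono imset_inE //; exact: H.
apply/nonsplitP/nonsplitP=> H J.
  move=> cJ uJ sJ; apply/eqP; rewrite -(imset_eq0 h); apply/eqP; apply: H.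
  - by rewrite cvx.
  - by rewrite imset_inE.
  by rewrite plift_stable.
move=> cJ uJ sJ; have JK : J \subset h @: K by case/convexP: cJ.
have JE := sub_imsetK JK; rewrite JE in cJ uJ sJ *.
rewrite (H (h @^-1: J)) ?imset0 //.
- by rewrite -cvx.
- by rewrite -(imset_inE h_inj).
by rewrite -(plift_stable h_inj).
Qed.

Lemma card_conn_diagrams_imset m N (h : 'I_m -> 'I_N) (K : {set 'I_m}) u :
  {mono h : x y / x < y} -> injective h ->
  #|conn_diagrams (h @: K) (h u)| = #|conn_diagrams K u|.
Proof.
move=> h_mono h_inj; apply: (@card_inj_preim _ _ (plift h)); first exact: plift_inj.
  move=> b; rewrite !inE plift_on // plift_invol // plift_nonsplit // plift_fix //.
  by rewrite imset_eq0.
move=> b /conn_diagramsP[bK _ _ _]; apply: plift_surj => //.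
by apply: subset_trans bK _; apply: imsetS; exact: subsetT.
Qed.

Definition conn_diagram_count m := #|conn_diagrams [set: 'I_m.+1] ord0|.

(** Unlike for graphs the order matters: the transport uses the increasing enumeration of [K], and
    [u] must be least to correspond to [ord0]. *)
Lemma card_conn_diagrams N (K : {set 'I_N}) u m : u \in K -> (forall x, x \in K -> u <= x) ->
  #|K| = m.+1 -> #|conn_diagrams K u| = conn_diagram_count m.
Proof.
move=> uK umin Km; pose h (i : 'I_m.+1) := enum_val (cast_ord (esym Km) i).
have srt : sorted (relpre val ltn) (enum K).
  rewrite /enum_mem; apply: sorted_filter => [y x z|]; first exact: ltn_trans.
  by rewrite -enumT -sorted_map val_enum_ord iota_ltn_sorted.
have h_homo (i j : 'I_m.+1) : i < j -> h i < h j.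
  move=> ij; rewrite /h !(enum_val_nth u).
  apply: (sorted_ltn_nth _ u srt) => //=; last 2 first.
  - by rewrite inE -cardE Km.
  - by rewrite inE -cardE Km.
  by move=> y x z; exact: ltn_trans.
have h_mono : {mono h : x y / x < y}.
  move=> i j; apply/idP/idP=> [|/h_homo //]; rewrite [i < j]ltnNge; apply: contraTN.
  by rewrite leq_eqVlt -leqNgt => /orP[/eqP/val_inj -> //|/h_homo/ltnW].
have h_inj : injective h by move=> i j /enum_val_inj/cast_ord_inj.
have hK : h @: setT = K.
  apply/eqP; rewrite eqEcard card_imset // cardsT card_ord Km leqnn andbT.
  by apply/subsetP=> _ /imsetP[i _ ->]; exact: enum_valP.
have h0 : h ord0 = u.
  have /imsetP[i _ ui] : u \in h @: setT by rewrite hK.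
  apply/val_inj/eqP; rewrite eqn_leq umin ?enum_valP // andbT ui.
  by have [->//|i0] := eqVneq i ord0; apply/ltnW/h_homo; rewrite lt0n.
by rewrite /conn_diagram_count -(card_conn_diagrams_imset setT ord0 h_mono h_inj) hK h0.
Qed.

Lemma conn_diagram_count_even m : ~~ odd m -> conn_diagram_count m = 0.
Proof.
move=> mo; apply/eqP; rewrite cards_eq0; apply/eqP/setP=> b; rewrite in_set0.
apply/negP=> /conn_diagramsP[_ bI bF _]; have := card_boson_edges bI.
have -> : [set v | b v != v] = setT by apply/setP=> v; rewrite !inE bF ?inE.
by rewrite cardsT card_ord => e; have := odd_double #|boson_edges b|; rewrite e /= mo.
Qed.

Lemma conn_diagram_count1 : conn_diagram_count 1 = 1.
Proof.
apply/eqP/cards1P; exists (tperm ord0 ord_max).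
have two (x : 'I_2) : x = ord0 \/ x = ord_max.
  by case: x => [[|[|k]] hk]; [left | right | lia]; exact: val_inj.
apply/setP=> b; rewrite in_set1; apply/conn_diagramsP/eqP => [[_ _ bF _]|->].
  have b0 := bF ord0 (in_setT _); have b1 := bF ord_max (in_setT _).
  apply/permP=> x; case: (two x) => ->; rewrite ?tpermL ?tpermR.
    by case: (two (b ord0)) b0 => ->.
  by case: (two (b ord_max)) b1 => ->.
split; first exact: perm_onT.
- by apply/involP=> x; rewrite tpermK.
- by move=> x _; case: (two x) => ->; rewrite ?tpermL ?tpermR.
apply/nonsplitP=> J _ J0 /stableP sJ; apply/setP=> x; rewrite inE; apply/negP=> xJ.
have := sJ x xJ; case: (two x) xJ => -> xJ; first by rewrite (negbTE J0) in xJ.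
by rewrite tpermR (negbTE J0).
Qed.

(** * The recursion for chord diagrams *)

Section Slots.
Variable N : nat.
Implicit Types (b : {perm 'I_N}) (K J S R : {set 'I_N}) (x y z : 'I_N).
Variables (u e t : 'I_N).
Hypotheses (u0 : u = 0 :> nat) (e1 : e = 1 :> nat) (tN : t.+1 = N) (et : e < t).

Lemma convexI K R J : convex K J -> R \subset K -> convex R (J :&: R).
Proof.
move=> /convexP[JK H] RK; apply/convexP; split=> [|x y z]; first exact: subsetIr.
rewrite !inE => /andP[xJ xR] /andP[zJ zR] yR xy yz.
by rewrite yR andbT; apply: (H x y z) => //; exact: (subsetP RK).
Qed.

(* [u], [e] and [t] are the points 0, 1 and the last one; a slot is {0} U B. *)
Definition slot S :=
  [&& u \in S, e \notin S, t \notin S, S != [set u] & convex setT (S :\ u)].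

Definition filling b S := slot S && stable b S.

Definition top_filling b S :=
  filling b S && [forall S' : {set 'I_N}, filling b S' ==> (S' \subset S)].

Lemma top_fillingP b S :
  reflect (filling b S /\ forall S', filling b S' -> S' \subset S) (top_filling b S).
Proof.
apply: (iffP andP) => -[-> h]; split=> //.
  by move=> S'; have /forallP/(_ S')/implyP := h.
by apply/forallP=> S'; apply/implyP; exact: h.
Qed.

Let gte x : x != u -> x != e -> e < x.
Proof. by move=> xu xe; rewrite ltn_neqAle eq_sym xe e1 lt0n -u0. Qed.

Let ltt x : x != t -> x < t.
Proof. by move=> xt; rewrite ltn_neqAle xt -ltnS tN ltn_ord. Qed.

Let ue : u != e. Proof. by rewrite -val_eqE /= u0 e1. Qed.
Let te : t != e. Proof. by rewrite -val_eqE /= neq_ltn et orbT. Qed.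

Let neu (x y : 'I_N) : x < y -> y != u.
Proof. by move=> xy; rewrite -val_eqE /= u0 -lt0n (leq_ltn_trans _ xy). Qed.

Let tu : t != u. Proof. by rewrite -val_eqE /= u0 -lt0n (leq_ltn_trans _ et). Qed.

Lemma slotP S : reflect
  [/\ u \in S, e \notin S, t \notin S, exists2 y, y \in S & y != u &
      forall x y z, x \in S -> x != u -> z \in S -> x < y -> y < z -> y \in S]
  (slot S).
Proof.
apply: (iffP and5P) => [[uS eS tS Su /convexP[_ H]]|[uS eS tS [y yS yu] H]]; split=> //.
- have /set0Pn[y] : S :\ u != set0.
    by apply: contra Su => /eqP S0; rewrite -(setD1K uS) S0 setU0.
  by rewrite !inE => /andP[yu yS]; exists y.
- move=> x y z xS xu zS xy yz; have zu := neu yz.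
  have := H x y z; rewrite !inE xu xS zu zS => /(_ isT isT isT xy yz).
  by case/andP.
- by apply: contraNneq yu => S1; move: yS; rewrite S1 inE.
apply/convexP; split=> [|x y1 z]; first exact: subsetT.
rewrite !inE => /andP[xu xS] /andP[zu zS] _ xy yz.
by rewrite (H x y1 z) // andbT (neu xy).
Qed.

(** Both intervals contain the partner [b u] of the first point, so they overlap and their union is
    an interval. *)
Lemma fillingU b S S' : filling b S -> filling b S' -> b u != u -> filling b (S :|: S').
Proof.
move=> /andP[/slotP[uS eS tS [y yS yu] HS] sS] /andP[/slotP[uS' eS' tS' _ HS'] sS'] bu.
apply/andP; split; last exact: stableU.
have wS : b u \in S by rewrite stableE.
have wS' : b u \in S' by rewrite stableE.
apply/slotP; split; rewrite ?inE ?uS ?(negbTE eS) ?(negbTE tS) //.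
  by exists y; rewrite // inE yS.
have mix (A B : {set 'I_N}) : b u \in A -> b u \in B ->
    (forall x y z, x \in A -> x != u -> z \in A -> x < y -> y < z -> y \in A) ->
    (forall x y z, x \in B -> x != u -> z \in B -> x < y -> y < z -> y \in B) ->
    forall x y z, x \in A -> x != u -> z \in B -> x < y -> y < z -> y \in A :|: B.
  move=> wA wB HA HB x y1 z xA xu zB xy yz; rewrite inE.
  have [yw|wy|/val_inj ->] := ltngtP y1 (b u).
  - by rewrite (HA x y1 (b u)).
  - by rewrite (HB (b u) y1 z) ?orbT.
  - by rewrite wA.
move=> x y1 z; rewrite inE => /orP[xS|xS] xu; rewrite inE => /orP[zS|zS] xy yz.
- by rewrite inE (HS x y1 z).
- exact: (mix S S' wS wS' HS HS' x y1 z).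
- rewrite setUC; exact: (mix S' S wS' wS HS' HS x y1 z).
- by rewrite inE (HS' x y1 z) ?orbT.
Qed.

Lemma top_filling_exists b : b \in conn_diagrams setT u -> exists S, top_filling b S.
Proof.
move=> /conn_diagramsP[_ bI bF /nonsplitP bS]; have bu := bF u (in_setT _).
have st2 (x : 'I_N) : b u = x -> stable b (~: [set u; x]).
  move=> bux; have bx : b x = u by rewrite -bux (involP _ bI).
  apply: stable_eq => y; rewrite !inE.
  have -> : (b y == u) = (y == x) by rewrite -{1}bx (inj_eq perm_inj).
  have -> : (b y == x) = (y == u) by rewrite -{1}bux (inj_eq perm_inj).
  by rewrite orbC.
(* If [u] were joined to [e] or [t], the remaining points would form a stable interval. Hence the
   chord of [u] alone is already a filling. *)
have nS0 (x y : 'I_N) : x != y -> y != u -> convex setT (~: [set u; x]) -> b u != x.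
  move=> xy yu cx; apply/eqP=> /st2 sx; have := bS _ cx; rewrite !inE eqxx => /(_ isT sx).
  by move/setP/(_ y); rewrite !inE (negbTE yu) eq_sym (negbTE xy).
have bue : b u != e.
  apply: (nS0 e t) => //; first by rewrite eq_sym.
  apply/convexP; split=> [|x y z]; first exact: subsetT.
  rewrite !inE !negb_or => /andP[xu xe] _ _ xy yz; rewrite (neu xy).
  by apply: contraTneq xy => ->; rewrite -leqNgt ltnW // gte.
have but : b u != t.
  apply: (nS0 t e) => //; first by rewrite eq_sym.
  apply/convexP; split=> [|x y z]; first exact: subsetT.
  rewrite !inE !negb_or => _ /andP[_ zt] _ xy yz; rewrite (neu xy).
  by apply: contraTneq yz => ->; rewrite -leqNgt ltnW // ltt.
have f0 : filling b [set u; b u].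
  apply/andP; split; last first.
    by have := stableD (perm_on_stable (perm_onT b)) (st2 _ erefl); rewrite setTD setCK.
  apply/slotP; split; rewrite ?set21 //.
  - by rewrite !inE negb_or eq_sym ue eq_sym bue.
  - by rewrite !inE negb_or tu eq_sym but.
  - by exists (b u); rewrite ?set22.
  move=> x y z; rewrite !inE => /orP[->//|/eqP->] _ /orP[]/eqP-> xy yz.
    by rewrite u0 ltn0 in yz.
  by have := ltn_trans xy yz; rewrite ltnn.
case: (arg_maxnP (fun S : {set 'I_N} => #|S|) f0) => S fS hS.
exists S; apply/top_fillingP; split=> // S' fS'.
have fU := fillingU fS fS' bu.
have /eqP -> : S == S :|: S' by rewrite eqEcard subsetUl; exact: hS.
exact: subsetUr.
Qed.

(** Splitting a diagram into its restrictions to [S] and to the complement, rooted at its first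
    point [e], is inverse to multiplying the two involutions. Connectedness of the complement
    corresponds to maximality of the filling. *)
Lemma card_top_filling S : slot S ->
  #|[set b in conn_diagrams setT u | top_filling b S]| = #|conn_diagrams S u| * #|conn_diagrams (~: S) e|.
Proof.
move=> slS; have [uS eS tS [w wS wu] HS] := slotP _ slS.
rewrite -cardsX.
pose f b := (restr S b, restr (~: S) b).
pose h (p : {perm 'I_N} * {perm 'I_N}) := (p.1 * p.2)%g.
have fP b : b \in [set b in conn_diagrams setT u | top_filling b S] ->
    f b \in setX (conn_diagrams S u) (conn_diagrams (~: S) e) /\ h (f b) = b.
  case/setIdP=> /conn_diagramsP[bT bI bF /nonsplitP bS] /top_fillingP[/andP[_ sS] topS].
  have sC : stable b (~: S) by apply: stable_eq => x; rewrite !inE stableE.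
  have inv R : stable b R -> invol (restr R b).
    move=> sR; apply/involP=> x; rewrite !restrE //.
    by have [xR|/negbTE ->//] := boolP (x \in R); rewrite stableE // xR (involP _ bI).
  have st R J : stable b R -> J \subset R -> stable (restr R b) J -> stable b J.
    move=> sR JR /stableP sJ; apply/stableP=> x xJ; have := sJ x xJ.
    by rewrite restrE // (subsetP JR).
  split; last first.
    apply/permP=> x; rewrite /h /f /= permM !restrE //.
    by have [xS|xS] := boolP (x \in S); rewrite inE ?stableE ?xS.
  rewrite inE; apply/andP; split; apply/conn_diagramsP; split.
  - exact: restr_on.
  - exact: inv.
  - by move=> x xS; rewrite restrE // xS bF ?inE.
  - apply/nonsplitP=> J /convexP[JS HJ] uJ sJ; apply: bS => //; last exact: (st _ _ sS JS sJ).
    apply/convexP; split=> [|x y z xJ zJ _ xy yz]; first exact: subsetT.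
    apply: (HJ x y z) => //; apply: (HS x y z) => //; try exact: (subsetP JS).
    by apply: contraNneq uJ => <-.
  - exact: restr_on.
  - exact: inv.
  - by move=> x xS; rewrite restrE // xS bF ?inE.
  apply/nonsplitP=> J cJ eJ sJ'; have [JC HJ] := convexP _ _ cJ.
  have sJ := st _ _ sC JC sJ'.
  have nJ x : x \in J -> x \notin S by move/(subsetP JC); rewrite inE.
  have uJ : u \notin J by apply/negP => /nJ; rewrite uS.
  have [cJT|ncJT] := boolP (convex setT J); first exact: bS.
  (* [J] surrounds [S :\ u], so [S] could be enlarged by [J]. *)
  have [x0 [y0 [z0 [x0J z0J y0S x0y0 y0z0]]]] :
      exists x y z, [/\ x \in J, z \in J, y \in S, x < y & y < z].
    have [/existsP[x /existsP[y /existsP[z /and5P[xJ zJ yS xy yz]]]]|H] := boolP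
      [exists x, exists y, exists z, [&& x \in J, z \in J, y \in S, x < y & y < z]].
      by exists x, y, z.
    case/negP: ncJT; apply/convexP.
    split=> [|x y z xJ zJ _ xy yz]; first exact: subsetT.
    apply: (HJ x y z) => //; rewrite inE; apply/negP=> yS; case/negP: H.
    apply/existsP; exists x; apply/existsP; exists y; apply/existsP; exists z.
    by apply/and5P.
  have cU x y z : x \in J :|: S -> x != u -> z \in J :|: S -> z != u ->
      x < y -> y < z -> y \in J :|: S.
    move=> xU xu zU zu xy yz; rewrite inE orbC; have [//|yS] := boolP (y \in S).
    have y0u := neu x0y0.
    have HJ' x1 z1 : x1 \in J -> z1 \in J -> x1 < y -> y < z1 -> y \in J.
      by move=> x1J z1J; apply: HJ => //; rewrite inE.
    have HS' x1 z1 : x1 \in S -> x1 != u -> z1 \in S -> x1 < y -> y < z1 -> False.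
      by move=> x1S x1u z1S xy1 yz1; move/negP: yS; apply; exact: (HS x1 y z1).
    have yy0 : y != y0 :> nat by apply: contraNneq yS => /val_inj ->.
    move: xU zU; rewrite !inE => /orP[xJ|xS] /orP[zJ|zS].
    + exact: (HJ' x z).
    + have [yl|yg] := leqP y y0.
        by apply: (HJ' x z0) => //; exact: leq_ltn_trans yl y0z0.
      by case: (HS' y0 z).
    + have [yl|yg] := leqP y y0.
        by case: (HS' x y0) => //; rewrite ltn_neqAle yy0.
      by apply: (HJ' x0 z) => //; exact: ltn_trans x0y0 yg.
    by case: (HS' x z).
  have sU : stable b (J :|: S) by exact: stableU.
  (* If [J] reaches the last point, the points outside [J :|: S] form a stable interval containing
     [e], which is impossible. Otherwise [J :|: S] is a filling, so [J] lies in [S] by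
     maximality. *)
  have [tJ|tJ] := boolP (t \in J).
    have eU : e \in ~: (J :|: S) by rewrite !inE negb_or eJ eS.
    have R0 : ~: (J :|: S) = set0; last by rewrite R0 inE in eU.
    apply: bS; last by apply: stable_eq => x; rewrite inE [in RHS]inE stableE.
      apply/convexP; split=> [|x y z xR zR _ xy yz]; first exact: subsetT.
      rewrite inE; apply: contraTN zR => yU; rewrite inE negbK.
      have yu := neu xy.
      have [->|zt] := eqVneq z t; first by rewrite inE tJ.
      by apply: (cU y z t) => //; rewrite ?inE ?tJ // ltt.
    by rewrite !inE uS orbT.
  have fU : filling b (J :|: S).
    apply/andP; split=> //; apply/slotP; split.
    - by rewrite inE uS orbT.
    - by rewrite inE negb_or eJ.
    - by rewrite inE negb_or tJ.
    - by exists w; rewrite // inE wS orbT.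
    move=> x y z xU xu zU xy yz; apply: (cU x y z) => //.
    exact: neu yz.
  apply/setP=> x; rewrite inE; apply/negP=> xJ; have := nJ x xJ.
  by rewrite (subsetP (topS _ fU)) // inE xJ.
have hP p : p \in setX (conn_diagrams S u) (conn_diagrams (~: S) e) ->
    h p \in [set b in conn_diagrams setT u | top_filling b S] /\ f (h p) = p.
  case: p => b1 b2; rewrite inE => /andP[/conn_diagramsP[b1S b1I b1F /nonsplitP b1U]].
  move=> /conn_diagramsP[b2S b2I b2F /nonsplitP b2U]; rewrite /h /=.
  have e1x x : x \in S -> (b1 * b2)%g x = b1 x.
    by move=> xS; rewrite permM (out_perm b2S) // inE negbK (perm_closed _ b1S).
  have e2x x : x \notin S -> (b1 * b2)%g x = b2 x.
    by move=> xS; rewrite permM (out_perm b1S).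
  have sS : stable (b1 * b2)%g S.
    by apply/stableP=> x xS; rewrite e1x // (perm_closed _ b1S).
  have sC : stable (b1 * b2)%g (~: S) by apply: stable_eq => x; rewrite !inE stableE.
  have st1 J : J \subset S -> stable (b1 * b2)%g J -> stable b1 J.
    move=> JS /stableP sJ; apply/stableP=> x xJ; have := sJ x xJ.
    by rewrite e1x // (subsetP JS).
  have st2 J : J \subset ~: S -> stable (b1 * b2)%g J -> stable b2 J.
    move=> JS /stableP sJ; apply/stableP=> x xJ; have := sJ x xJ.
    by rewrite e2x //; have := subsetP JS x xJ; rewrite inE.
  have cd : (b1 * b2)%g \in conn_diagrams setT u.
    apply/conn_diagramsP; split; first exact: perm_onT.
    - apply/involP=> x; have [xS|xS] := boolP (x \in S).
        by rewrite (e1x x) // e1x ?(perm_closed _ b1S) // (involP _ b1I).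
      rewrite (e2x x) // e2x ?(involP _ b2I) //.
      by rewrite -in_setC (perm_closed _ b2S) inE.
    - move=> x _; have [xS|xS] := boolP (x \in S); first by rewrite e1x // b1F.
      by rewrite e2x // b2F // inE.
    apply/nonsplitP=> J cJ uJ sJ; have [_ HJ] := convexP _ _ cJ.
    (* The trace of [J] on [S] is a stable interval of [S] avoiding its root. *)
    have JS0 : J :&: S = set0.
      apply: b1U; first exact: convexI cJ (subsetT _).
        by rewrite inE (negbTE uJ).
      by apply: st1; [exact: subsetIr | exact: stableI].
    have nJ x : x \in J -> x \notin S.
      by move=> xJ; apply/negP=> xS; move/setP/(_ x): JS0; rewrite !inE xJ xS.
    have JC : J \subset ~: S by apply/subsetP=> x /nJ; rewrite inE.
    have cJC : convex (~: S) J by rewrite -(setIidPl JC); exact: convexI cJ (subsetT _).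
    (* If [J] contains [e], it cannot contain [t], as it would then contain all of [S] but [u]. The
       points of the complement of [S] beyond [J] then form a stable interval that avoids [e] and
       contains [t], a contradiction. *)
    have [eJ|eJ] := boolP (e \in J); last by apply: b2U => //; exact: st2.
    have tJ : t \notin J.
      apply/negP=> tJ; have wJ : w \in J; last by have := nJ w wJ; rewrite wS.
      apply: (HJ e w t) => //; last by apply: ltt; apply: contraNneq tS => <-.
        by rewrite inE.
      by apply: gte => //; apply: contraNneq eS => <-.
    have R0 : ~: S :\: J = set0.
      apply: b2U; last by apply: st2; [exact: subsetDl | exact: stableD].
        apply/convexP; split=> [|x y z]; first exact: subsetDl.
        rewrite !inE => /andP[xJ xS] /andP[zJ zS] yS xy yz; rewrite yS andbT.
        apply: contra (xJ) => yJ; apply: (HJ e x y) => //; first by rewrite inE.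
        apply: gte; first by apply: contraNneq xS => ->.
        by apply: contraNneq xJ => ->.
      by rewrite !inE eJ.
    by move/setP/(_ t): R0; rewrite !inE tJ tS.
  split; last first.
    rewrite /f; congr pair; apply/permP=> x; rewrite restrE // ?inE.
      by have [xS|xS] := boolP (x \in S); [exact: e1x | rewrite (out_perm b1S)].
    have [xS|xS] := boolP (x \in S); last exact: e2x.
    by rewrite (out_perm b2S) // inE negbK.
  apply/setIdP; split=> //; apply/top_fillingP; split; first by apply/andP.
  (* For any other filling [S'], the part outside [S] is a stable interval of the complement
     avoiding [e], hence empty. *)
  move=> S' /andP[/slotP[uS' eS' tS' _ HS'] sS'].
  rewrite -setD_eq0; apply/eqP; have RC : S' :\: S \subset ~: S.
    by apply/subsetP=> x; rewrite !inE => /andP[].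
  apply: b2U; last by apply: st2 => //; exact: stableD.
    apply/convexP; split=> // x y z.
    rewrite !inE => /andP[xS xS'] /andP[zS zS'] yS xy yz; rewrite yS.
    apply: (HS' x y z) => //; by apply: contraNneq xS => ->.
  by rewrite !inE (negbTE eS') andbF.
apply: (@card_in_bij _ _ _ _ f h) => x xP.
- by have [] := fP x xP.
- by have [] := hP x xP.
- by have [] := fP x xP.
- by have [] := hP x xP.
Qed.

End Slots.

Lemma card_ord_interval n a l : a + l <= n -> #|[set x : 'I_n | a <= x < a + l]| = l.
Proof.
elim: l => [|l IH] aln.
  by rewrite addn0; apply: eq_card0 => x; rewrite inE ltnNge andbN.
have lt_al : a + l < n by lia.
rewrite (cardsD1 (Ordinal lt_al)) inE /= addnS leq_addr leqnn add1n -[in RHS]IH; last lia.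
congr _.+1; apply: eq_card => x; rewrite !inE -val_eqE /=; lia.
Qed.

(** * Slots as intervals of points *)

Section SlotSum.
Variable M : nat.
Let N := M.+4.
Let u : 'I_N := ord0.
Let e : 'I_N := inord 1.
Let t : 'I_N := ord_max.

(** The interval starts at [p.1 + 2], past the points 0 and 1, and has [p.2 + 1] points, so it is
    nonempty. The condition [p.1 + p.2 <= M] keeps it below the last point [M + 3]. *)
Definition slot_set (p : 'I_M.+1 * 'I_M.+1) : {set 'I_M.+4} :=
  ord0 |: [set x : 'I_M.+4 | p.1.+2 <= x < p.1.+2 + p.2.+1].

Let e1 : e = 1 :> nat. Proof. by rewrite inordK. Qed.

Lemma card_slot_set (p : 'I_M.+1 * 'I_M.+1) : p.1 + p.2 <= M -> #|slot_set p| = p.2.+2.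
Proof. by move=> le; rewrite cardsU1 inE /= card_ord_interval //; lia. Qed.

Lemma slot_setE (p : 'I_M.+1 * 'I_M.+1) (x : 'I_N) :
  (x \in slot_set p) = (x == 0 :> nat) || (p.1.+2 <= x < p.1.+2 + p.2.+1).
Proof. by rewrite !inE -val_eqE. Qed.

Lemma slot_slot_set (p : 'I_M.+1 * 'I_M.+1) : p.1 + p.2 <= M -> slot u e t (slot_set p).
Proof.
move=> le; apply/slotP => //; split.
- by rewrite slot_setE.
- by rewrite slot_setE e1.
- by rewrite slot_setE /=; lia.
- have lt : p.1.+2 < N by rewrite /N; lia.
  by exists (Ordinal lt); rewrite ?slot_setE //=; lia.
move=> x y z; rewrite !slot_setE -val_eqE /=; lia.
Qed.

Lemma slot_set_exists S : slot u e t S ->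
  exists2 p : 'I_M.+1 * 'I_M.+1, p.1 + p.2 <= M & S = slot_set p.
Proof.
case/(@slotP _ u e t erefl) => uS eS tS [w wS wu] HS.
pose P (x : 'I_N) := (x \in S) && (x != u).
have Pw : P w by rewrite /P wS.
case: (arg_minnP (fun x : 'I_N => nat_of_ord x) Pw) => a /andP[aS au] amin.
case: (arg_maxnP (fun x : 'I_N => nat_of_ord x) Pw) => c /andP[cS cu] cmax.
have a0 : a != 0 :> nat by rewrite -[0]/(nat_of_ord u) val_eqE.
have a1 : a != 1 :> nat by apply: contraNneq eS => a1; rewrite (_ : e = a) //; apply: val_inj; rewrite /= e1 a1.
have c3 : c < M.+3.
  have cM := ltn_ord c; rewrite ltn_neqAle -ltnS cM andbT.
  by apply: contraNneq tS => c3; rewrite (_ : t = c) //; exact: val_inj.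
have ac : a <= c := amin c (introT andP (conj cS cu)).
have a2 : 1 < a by move: a0 a1; case: (nat_of_ord a) => [|[]].
have pa : a - 2 < M.+1 by move: ac c3; clear; lia.
have pc : c - a < M.+1 by move: c3 a2; clear; lia.
exists (Ordinal pa, Ordinal pc) => /=; first by move: a2 ac c3; clear; lia.
apply/setP=> x; rewrite slot_setE /=.
have -> : (a - 2).+2 = a by move: a2; clear; lia.
have -> : a + (c - a).+1 = c.+1 by move: ac; clear; lia.
rewrite ltnS; apply/idP/idP=> [xS|/orP[x0|/andP[ax xc]]].
- have [->//|xu] := eqVneq x u; have Px : P x by rewrite /P xS.
  have xc : x <= c := cmax x Px.
  by rewrite (amin x Px) xc orbT.
- by rewrite (_ : x = u) //; apply/val_inj/eqP.
have [ax'|ax'] := eqVneq a x; first by rewrite -ax'.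
have [cx'|cx'] := eqVneq x c; first by rewrite cx'.
by apply: (HS a x c) => //; rewrite ltn_neqAle ?ax ?xc andbT.
Qed.

Lemma slot_set_inj (p q : 'I_M.+1 * 'I_M.+1) : p.1 + p.2 <= M -> q.1 + q.2 <= M ->
  slot_set p = slot_set q -> p = q.
Proof.
case: p q => [a k] [c l] /= ak cl E.
have kl : k = l :> nat.
  have := card_slot_set (p := (a, k)) ak; rewrite E card_slot_set //= => -[]; lia.
have aN : a.+2 < N by rewrite /N; lia.
have cN : c.+2 < N by rewrite /N; lia.
have := slot_setE (a, k) (Ordinal aN); rewrite E slot_setE /= => h1.
have := slot_setE (a, k) (Ordinal cN); rewrite E slot_setE /= => h2.
by congr pair; apply: val_inj => /=; lia.
Qed.

Lemma conn_diagram_count_slots : conn_diagram_count M.+3 =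
  \sum_(p : 'I_M.+1 * 'I_M.+1 | p.1 + p.2 <= M) conn_diagram_count p.2.+1 * conn_diagram_count (M - p.2).+1.
Proof.
have tN : t.+1 = N by [].
have u0 : u = 0 :> nat by [].
have et : e < t by rewrite e1.
rewrite /conn_diagram_count (@card_fibers _ _ _ [set p : 'I_M.+1 * 'I_M.+1 | p.1 + p.2 <= M]
  (fun b p => top_filling u e t b (slot_set p))); last first.
  move=> b bP; have [S /[dup] topS] := top_filling_exists u0 e1 tN et bP.
  case/andP => /andP[/slot_set_exists[p pM SE] _] _.
  exists p; rewrite ?inE // => q; rewrite inE => qM; apply/idP/eqP => [top|->]; last by rewrite -SE.
  apply: slot_set_inj => //; rewrite -SE; apply/eqP.
  have /top_fillingP[fq Hq] := top; have /top_fillingP[fS HS] := topS.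
  by rewrite eqEsubset HS // Hq.
apply: eq_big => [p|p]; rewrite inE // => pM.
rewrite (card_top_filling u0 e1 tN et (slot_slot_set pM)).
congr (_ * _); apply: card_conn_diagrams => //.
- by rewrite slot_setE.
- exact: card_slot_set.
- by rewrite inE slot_setE e1.
- move=> x; rewrite inE slot_setE negb_or e1 => /andP[x0 _]; lia.
by rewrite cardsCs setCK card_ord card_slot_set //; lia.
Qed.

(** The factor [(M - k).+1] counts the starting points of an interval of [k + 1] points, that is,
    the inner gaps of the complement, which has [M - k + 2] points. *)
Lemma conn_diagram_count_rec : conn_diagram_count M.+3 =
  \sum_(k < M.+1) (M - k).+1 * conn_diagram_count k.+1 * conn_diagram_count (M - k).+1.
Proof.
rewrite conn_diagram_count_slots.
rewrite (eq_bigl (fun p : 'I_M.+1 * 'I_M.+1 => true && (p.1 + p.2 <= M))) //.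
rewrite -(pair_big_dep predT (fun a k : 'I_M.+1 => a + k <= M)
  (fun (_ k : 'I_M.+1) => conn_diagram_count k.+1 * conn_diagram_count (M - k).+1)) /=.
rewrite (exchange_big_dep predT) //=; apply: eq_bigr => k _.
rewrite sum_nat_const -mulnA; congr (_ * _).
rewrite -[RHS](@card_ord_interval M.+1 0) ?add0n //; last lia.
by apply: eq_card => a; rewrite inE unfold_in /=; have := ltn_ord k; lia.
Qed.

End SlotSum.

(** * Chord diagrams as involutions *)

Lemma connect_invariant (T : finType) (e : rel T) (P : pred T) x y :
  (forall a b, e a b -> P a -> P b) -> connect e x y -> P x -> P y.
Proof.
move=> eP /connectP[p + ->]; elim: p x => //= a p IH x /andP[xa pth] Px.
exact: IH pth (eP _ _ xa Px).
Qed.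

Section Matchings.
Variable N : nat.
Implicit Types (b : {perm 'I_N}) (M : {set {set 'I_N}}) (C D J : {set 'I_N}).
Implicit Types (x y z : 'I_N).

Lemma perfect_matching_boson b : invol b -> (forall x, b x != x) ->
  perfect_matching (boson_edges b).
Proof.
move=> bI bF; have [P C2] := boson_edges_partition bI.
apply/andP; split; last by apply/forall_inP=> C /C2 ->.
by move: P; rewrite (_ : [set v | b v != v] = setT) //; apply/setP=> v; rewrite !inE bF.
Qed.

Lemma perfect_matching_perm M : perfect_matching M ->
  exists b, [/\ invol b, forall x, b x != x & boson_edges b = M].
Proof.
case/andP=> P /forall_inP M2; have [/eqP covM trM M0] := and3P P.
have pbM x : pblock M x \in M by rewrite pblock_mem // covM inE.
have xpb x : x \in pblock M x by rewrite mem_pblock covM inE.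
(* The other point of the block of [x]; the default is never taken since blocks have two points. *)
pose f x := odflt x [pick y in pblock M x :\ x].
have fP x : f x != x /\ pblock M x = [set x; f x].
  have /cards1P[y yE] : #|pblock M x :\ x| == 1.
    by have := M2 _ (pbM x); rewrite (cardsD1 x) xpb add1n => /eqP[->].
  have fy : f x = y.
    rewrite /f; case: pickP => [z|/(_ y)]; rewrite yE in_set1; first by move/eqP.
    by rewrite eqxx.
  have : y \in pblock M x :\ x by rewrite yE set11.
  by rewrite !inE => /andP[yx _]; rewrite fy -yE setD1K.
have ff : involutive f.
  move=> x; have [fx pE] := fP x; have [ffx] := fP (f x).
  have -> : pblock M (f x) = pblock M x.
    by apply: (def_pblock trM (pbM x)); rewrite pE set22.
  rewrite pE => /setP/(_ (f (f x))); rewrite !inE eqxx orbT (negbTE ffx) orbF.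
  by move/eqP.
have bE := perm_funE (inv_inj ff).
exists (perm_fun f); split.
- by apply/involP=> x; rewrite !bE ff.
- by move=> x; rewrite bE; case: (fP x).
apply/setP=> C; apply/imsetP/idP => [[x _ ->]|CM].
  by rewrite bE; case: (fP x) => _ <-; exact: pbM.
have /set0Pn[x xC] : C != set0 by apply: contraNneq M0 => <-.
exists x; first by rewrite inE bE; case: (fP x).
by rewrite bE -(def_pblock trM CM xC); case: (fP x).
Qed.

Lemma boson_edges_inj b1 b2 : invol b1 -> invol b2 -> (forall x, b1 x != x) ->
  boson_edges b1 = boson_edges b2 -> b1 = b2.
Proof.
move=> b1I b2I b1F e; apply/permP=> x.
have C1 : [set x; b1 x] \in boson_edges b2.
  by rewrite -e; apply/imsetP; exists x; rewrite ?inE.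
have [/setP/(_ (b1 x)) + _] := boson_edgesE b2I C1 (set21 _ _).
by rewrite !inE eqxx orbT (negbTE (b1F x)) => /esym/eqP.
Qed.

Lemma chords_cross_sym : symmetric (@chords_cross N).
Proof.
have imp C D : chords_cross C D -> chords_cross D C.
  case/existsP=> a /existsP[z /existsP[c /existsP[d /and5P[aC zC cD dD h]]]].
  apply/existsP; exists c; apply/existsP; exists d.
  apply/existsP; exists a; apply/existsP; exists z.
  by rewrite aC zC cD dD orbC.
by move=> C D; apply/idP/idP; exact: imp.
Qed.

Lemma intersection_rel_sym M : symmetric (intersection_rel M).
Proof. by move=> C D; rewrite /intersection_rel andbCA chords_cross_sym. Qed.

Lemma chords_cross_between C D : chords_cross C D ->
  exists a z c, [/\ a \in C, z \in C, c \in D, a < c & c < z].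
Proof.
case/existsP=> a /existsP[z /existsP[c /existsP[d /and5P[aC zC cD dD]]]].
case/orP=> [/andP[/andP[ac cz] _]|/andP[/andP[_ ad] dz]].
  by exists a, z, c.
by exists a, z, d.
Qed.

(** A chord that crosses a chord inside a stable interval has an end in it, hence lies in it, so no
    path leads from there to the chord of [u]. Conversely, let [S] be the points whose chords are
    connected to that of [u]; a gap between points of [S] is a stable interval avoiding [u], hence
    empty. *)
Lemma cd_connected_nonsplit b (u : 'I_N) : u = 0 :> nat -> invol b -> (forall x, b x != x) ->
  cd_connected (boson_edges b) = nonsplit b setT u.
Proof.
move=> u0 bI bF; set M := boson_edges b.
have chM x : [set x; b x] \in M by apply/imsetP; exists x; rewrite ?inE.
have chE C x : C \in M -> x \in C -> C = [set x; b x].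
  by move=> CM xC; have [] := boson_edgesE bI CM xC.
have csym := sym_connect_sym (intersection_rel_sym M).
apply/idP/nonsplitP => [/forall_inP conn J cJ uJ sJ|split].
  apply/setP=> x; rewrite inE; apply/negP=> xJ.
  have /forall_inP/(_ _ (chM u)) := conn _ (chM x).
  move/(@connect_invariant _ _ (fun C : {set 'I_N} => C \subset J)) => /=.
  rewrite !subUset !sub1set xJ stableE // xJ (negbTE uJ) => H.
  suff: false by []; apply: H => // C D /and3P[CM DM /chords_cross_between].
  case=> [a [z [c [aC zC cD ac cz]]]] CJ; have [_ HJ] := convexP _ _ cJ.
  have cJ' : c \in J by apply: (HJ a c z) => //; rewrite ?inE // (subsetP CJ).
  by rewrite (chE D c) // subUset !sub1set cJ' stableE.
pose S := [set x | connect (intersection_rel M) [set u; b u] [set x; b x]].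
have uS : u \in S by rewrite inE connect0.
have bS x : (b x \in S) = (x \in S) by rewrite !inE (involP _ bI) (setUC [set b x]).
suff ST : S = setT.
  apply/forall_inP=> C CM; apply/forall_inP=> D DM.
  have toC E : E \in M -> connect (intersection_rel M) [set u; b u] E.
    move=> EM; have /set0Pn[x xE] : E != set0.
      by rewrite -card_gt0; have [_ ->] := boson_edges_partition bI.
    by rewrite (chE E x) //; have := in_setT x; rewrite -ST inE.
  by apply: connect_trans (toC D DM); rewrite csym toC.
(* A chord outside [S] cannot enclose a point of [S]: the chords of [S] on its
   two sides would not be connected. *)
have noenc lo s : lo \notin S -> s \in S -> lo < s -> s < b lo -> False.
  move=> loS sS los shi.
  have inside z : z \in S -> lo < z < b lo -> lo < b z < b lo.
    move=> zS /andP[loz zhi].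
    have bz1 : b z != lo by apply: contraNneq loS => <-; rewrite bS.
    have bz2 : b z != b lo by rewrite (inj_eq perm_inj); apply: contraNneq loS => <-.
    apply: contraNT loS => out_z; rewrite inE.
    have zc : connect (intersection_rel M) [set u; b u] [set z; b z].
      by move: zS; rewrite inE.
    apply: connect_trans zc (connect1 _); rewrite /intersection_rel !chM /=.
    have [bzlo|bzlo] := ltnP (b z) lo.
      apply/existsP; exists (b z); apply/existsP; exists z.
      apply/existsP; exists lo; apply/existsP; exists (b lo).
      by rewrite !set21 !set22 bzlo loz zhi.
    have lobz : lo < b z by rewrite ltn_neqAle eq_sym bz1.
    have hib : b lo < b z.
      rewrite ltn_neqAle leqNgt; apply/andP; split; first by rewrite eq_sym; exact: bz2.
      by move: out_z; rewrite lobz.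
    apply/existsP; exists z; apply/existsP; exists (b z).
    apply/existsP; exists lo; apply/existsP; exists (b lo).
    by rewrite !set21 !set22 loz zhi hib orbT.
  (* [P] passes to crossing chords, so it would reach the chord of [u]; but [u], being 0, is not
     above [lo]. *)
  pose P C := [forall x in C, lo < x < b lo] &&
    connect (intersection_rel M) [set u; b u] C.
  have Pin x : x \in S -> lo < x < b lo -> P [set x; b x].
    move=> xS xin; apply/andP; split; last by move: xS; rewrite inE.
    by apply/forall_inP=> z; rewrite !inE => /orP[]/eqP-> //; exact: inside.
  have Pstep C D : intersection_rel M C D -> P C -> P D.
    move=> CD /andP[/forall_inP Cin cC]; have /and3P[_ DM cr] := CD.
    have [a [z [c [aC zC cD ac cz]]]] := chords_cross_between cr.
    have cd := connect_trans cC (connect1 CD).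
    rewrite (chE D c DM cD) in cd *; apply: Pin; first by rewrite inE.
    have /andP[loa _] := Cin a aC; have /andP[_ zhi] := Cin z zC.
    by rewrite (ltn_trans loa ac) (ltn_trans cz zhi).
  have Ps : P [set s; b s] by apply: Pin => //; rewrite los.
  have su : connect (intersection_rel M) [set s; b s] [set u; b u].
    by rewrite csym; move: sS; rewrite inE.
  have /andP[/forall_inP/(_ u (set21 _ _))] := connect_invariant Pstep su Ps.
  by rewrite u0.
apply/setP=> x; rewrite in_setT; apply/negPn/negP=> xS.
pose btw x s y := (x <= s <= y) || (y <= s <= x).
(* The gap of [S] around [x]: the points that no point of [S] separates from [x]. *)
pose J := [set y | [forall s in S, ~~ btw x s y]].
have JP y : reflect (forall s, s \in S -> ~~ btw x s y) (y \in J).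
  by rewrite inE; exact: forall_inP.
have xJ : x \in J.
  apply/JP=> s sS; rewrite /btw orbb -eqn_leq; apply: contra xS => /eqP/val_inj ->.
  exact: sS.
have J0 : J = set0; last by rewrite J0 inE in xJ.
apply: split.
- apply/convexP; split=> [|y1 y y2 /JP h1 /JP h2 _ l1 l2]; first exact: subsetT.
  apply/JP=> s sS; move: (h1 s sS) (h2 s sS) l1 l2; rewrite /btw; clear; lia.
- by apply/negP=> /JP/(_ u uS); rewrite /btw u0 /= orbT.
(* If [b y] were outside the gap, the point [s] of [S] separating it from [x] would lie between [y]
   and [b y], against [noenc]. *)
apply/stableP=> y yJ; apply/JP=> s sS; have yb := JP _ yJ s sS.
have yS : y \notin S.
  by apply/negP=> yS; have := JP _ yJ y yS; rewrite /btw !leqnn andbT /= leq_total.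
apply/negP=> byb.
have sby : s != b y :> nat by apply: contraNneq yS => /val_inj e; rewrite -bS -e.
move: byb; rewrite /btw => /orP[/andP[xs sy]|/andP[ys sx]].
  apply: (noenc y s) => //; last by rewrite ltn_neqAle sby.
  by rewrite ltnNge; apply: contra yb => sy'; rewrite /btw xs sy'.
apply: (noenc (b y) s); rewrite ?bS ?(involP _ bI) //.
  by rewrite ltn_neqAle eq_sym sby.
by rewrite ltnNge; apply: contra yb => sy'; rewrite /btw sx sy' orbT.
Qed.

End Matchings.

Lemma chord_count_conn_diagrams n : chord_count n.+1 = conn_diagram_count n.*2.+1.
Proof.
rewrite /chord_count /conn_diagram_count doubleS.
have inj : {in conn_diagrams [set: 'I_n.*2.+2] ord0 &, injective (@boson_edges n.*2.+2)}.
  move=> b1 b2 /conn_diagramsP[_ b1I b1F _] /conn_diagramsP[_ b2I _ _]; apply: boson_edges_inj => // x.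
  by apply: b1F; rewrite inE.
rewrite -(card_in_imset inj); apply: eq_card => M; rewrite inE.
apply/andP/imsetP => [[/perfect_matching_perm[b [bI bF <-]] con]|[b /conn_diagramsP[_ bI bF bS] ->]].
  exists b => //; apply/conn_diagramsP; split=> //; first exact: perm_onT.
  by rewrite -cd_connected_nonsplit.
have bF' x : b x != x by apply: bF; rewrite inE.
by rewrite perfect_matching_boson // (@cd_connected_nonsplit _ _ ord0).
Qed.

Lemma chord_count1 : chord_count 1 = 1.
Proof. by rewrite chord_count_conn_diagrams conn_diagram_count1. Qed.

Lemma chord_count_rec n :
  chord_count n.+2 =
    \sum_(i < n.+1) (i.*2.+1) * chord_count i.+1 * chord_count (n - i).+1.
Proof.
rewrite chord_count_conn_diagrams doubleS conn_diagram_count_rec.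
pose F k := (n.*2 - k).+1 * conn_diagram_count k.+1 * conn_diagram_count (n.*2 - k).+1.
rewrite -(big_mkord predT F) /=.
have split2 p : \sum_(0 <= k < p.*2.+1) F k =
    \sum_(0 <= i < p.+1) F i.*2 + \sum_(0 <= i < p) F i.*2.+1.
  elim: p => [|p IH]; first by rewrite (_ : 0.*2 = 0) // !big_nat1 big_geq ?addn0.
  rewrite doubleS [LHS]big_nat_recr //= big_nat_recr //= IH.
  rewrite [\sum_(0 <= i < p.+2) _]big_nat_recr //= [\sum_(0 <= i < p.+1) F _.+1]big_nat_recr //=.
  by rewrite -doubleS; ring.
(* Odd [k] would give a diagram on an odd number of points. *)
rewrite split2 [X in _ + X]big1 ?addn0 => [|i _]; last first.
  by rewrite /F conn_diagram_count_even ?muln0 //= odd_double.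
(* The factor counts gaps of the complement, not of [S]; reversing the sum turns it into 2i+1. *)
rewrite big_mkord (reindex_inj rev_ord_inj) /=; apply: eq_bigr => i _.
have ile : i <= n by rewrite -ltnS.
by rewrite /F subSS -doubleB subKn // -!chord_count_conn_diagrams mulnAC.
Qed.

Lemma tadpole_count_chord_count n : tadpole_count n.+1 = chord_count n.+1.
Proof.
elim/ltn_ind: n => -[|n] IH; first by rewrite tadpole_count1 chord_count1.
rewrite tadpole_count_rec chord_count_rec; apply: eq_bigr => i _.
by rewrite !IH // ltnS ?leq_subr // -ltnS.
Qed.

(* T(x) = sum_n tadpole_count n x^n.  Part 1: T_n = C_n for n >= 1.
   Part 2: coefficientwise 2 x T T' = T^2 + T - x, i.e. for every n
   2 * sum_{i+j=n} j T_i T_j = sum_{i+j=n} T_i T_j + T_n - [n = 1]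
   (moved to one side to stay in nat). *)
Theorem theorem4p7p3 :
  (forall n : nat, 0 < n -> tadpole_count n = chord_count n) /\
  (forall n : nat,
     (\sum_(i < n.+1) tadpole_count i * tadpole_count (n - i) * (n - i)).*2
       + (n == 1)
     = \sum_(i < n.+1) tadpole_count i * tadpole_count (n - i) + tadpole_count n).
Proof.
split=> [[//|n] _|[|[|n]]]; first exact: tadpole_count_chord_count.
- by rewrite !big_ord1 tadpole_count0.
- by rewrite !big_ord_recl !big_ord0 /= tadpole_count0 tadpole_count1 !muln0.
(* Reversing the first sum gives each term the index of its other factor as weight; the two end
   terms vanish because T_0 = 0. *)
rewrite addn0 (reindex_inj rev_ord_inj) /=.
rewrite big_ord_recl big_ord_recr /= [in RHS]big_ord_recl [in RHS]big_ord_recr /=.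
rewrite tadpole_count_rec /bump /= !add1n !subnn !subn0 tadpole_count0.
rewrite !(mul0n, muln0, add0n, addn0) -mul2n big_distrr -big_split /=.
(* The terms agree one by one, since 2(i+1) = 1 + (2i+1). *)
apply: eq_bigr => i _; have ile : i <= n by rewrite -ltnS.
rewrite add1n !subSS; have -> : n.+2 - (n.+1 - i) = i.+1 by lia.
by rewrite subSn // -mul2n; ring.
Qed.
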